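(* Let $a\geq 0$ and let $\{f_n, n\in\mathbb{N}\}\subset \mathcal{L}^+_a$ be a sequence that converges uniformly on compact subsets of $\mathbb{C}$ to a function $f\in\mathcal{A}_a$ which does not vanish identically. Then $\{f_n\}$ is a bounded subset of $\mathcal{A}_a$, it converges to $f$ in the topology of $\mathcal{A}_a$, and $f\in\mathcal{L}^+$.
   Context: Let $\mathcal{E}$ denote the set of all entire functions. For $b>0$ and $f\in\mathcal{E}$ put $\|f\|_b=\sup_{k\in\mathbb{N}_0} b^{-k}|f^{(k)}(0)|$. For $a\geq 0$ let $\mathcal{A}_a=\{f\in\mathcal{E}: \|f\|_b<\infty \ \forall b>a\}$ with the locally convex topology generated by the norms $\{\|\cdot\|_b: b>a\}$; a subset $B$ is bounded in $\mathcal{A}_a$ if $\sup_{f\in B}\|f\|_b<\infty$ for every $b>a$. The class $\mathcal{L}^+$ (Laguerre entire functions) consists of all entire functions of the form $f(z)=Cz^l e^{\alpha z}\prod_{j=1}^\infty(1+\beta_j z)$ with $C\in\mathbb{C}$, $l\in\mathbb{N}_0$, $\alpha\geq 0$, $\beta_j\geq\beta_{j+1}\geq 0$ and $\sum_j\beta_j<\infty$. Put $\mathcal{L}^+_a=\mathcal{L}^+\cap\mathcal{A}_a$. *)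

(* Defs.v *)
(* The complex plane is modelled as
   R[i] (real_closed's complex numbers over a realType R), viewed as a normed
   module over itself via ^o, so that [derivable f z 1] is complex
   differentiability and [derive1n k f 0] is the k-th complex derivative
   f^(k)(0). *)
From HB Require Import structures.
From mathcomp Require Import all_boot all_order all_algebra.
From mathcomp Require Import all_classical all_reals all_analysis.
From mathcomp Require Import complex.
Set Implicit Arguments. Unset Strict Implicit. Unset Printing Implicit Defensive.
Import Order.TTheory GRing.Theory Num.Theory.
Import numFieldNormedType.Exports.
Local Open Scope ring_scope.
Local Open Scope complex_scope.
Local Open Scope classical_set_scope.

Local Notation normc := ComplexField.Normc.normc.

Definition CC (R : realType) : Type := (R[i])^o.

Section Defs.
Variable R : realType.
Local Notation C := (CC R).

Definition entire (f : C -> C) : Prop := forall z : C, derivable f z 1.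

Definition normA (b : R) (f : C -> C) : \bar R :=
  ereal_sup (range (fun k : nat => ((b ^- k) * normc (derive1n k f 0 : R[i]))%:E)).

Definition A_space (a : R) (f : C -> C) : Prop :=
  entire f /\ forall b : R, a < b -> (normA b f < +oo)%E.

Definition bounded_in_A (a : R) (B : set (C -> C)) : Prop :=
  forall b : R, a < b -> exists M : R, forall g, B g -> (normA b g <= M%:E)%E.

Definition cvg_in_A (a : R) (u : nat -> C -> C) (f : C -> C) : Prop :=
  forall b : R, a < b -> normA b (fun z => u n z - f z) @[n --> \oo] --> 0%E.

Definition cexp (z : C) : C :=
  lim (series (fun k : nat => (z ^+ k / (k`!)%:R : C)) @ \oo).

Definition cvg_compact (u : nat -> C -> C) (f : C -> C) : Prop :=
  forall K : set C, compact K ->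
  forall e : R, 0 < e ->
  \forall n \near \oo, forall z, K z -> normc (u n z - f z : R[i]) < e.

(* Laguerre entire functions L^+:
   f(z) = c z^l e^{alpha z} prod_{j>=1} (1 + beta_j z), the infinite product
   being the limit of its partial products (indices shifted to start at 0). *)
Definition Laguerre (f : C -> C) : Prop :=
  exists (c : C) (l : nat) (alpha : R) (beta : nat -> R),
    [/\ 0 <= alpha,
        (forall j, beta j.+1 <= beta j),
        (forall j, 0 <= beta j),
        cvg (series beta @ \oo) &
        forall z : C,
          (fun N : nat => c * z ^+ l * cexp (alpha%:C * z)
                          * \prod_(j < N) (1 + (beta j)%:C * z))
            @ \oo --> f z].

Definition Laguerre_a (a : R) (f : C -> C) : Prop := Laguerre f /\ A_space a f.

End Defs.

(* Main.v *)
Require Import Defs.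
From HB Require Import structures.
From mathcomp Require Import all_boot all_order all_algebra.
From mathcomp Require Import all_classical all_reals all_analysis.
From mathcomp Require Import complex ring lra zify.
Import Order.TTheory GRing.Theory Num.Theory.
Import numFieldNormedType.Exports.
Set Implicit Arguments. Unset Strict Implicit. Unset Printing Implicit Defensive.
Local Open Scope ring_scope.
Local Open Scope classical_set_scope.

(* Up to a constant factor, the derivatives [p k] at 0 of a Laguerre entire function form a
   nonnegative log-concave sequence, because multiplication by [s + b z] with [s, b >= 0]
   preserves log-concavity.  Nonnegativity bounds all the Taylor coefficients of [fs n] by
   its values on the positive axis, so pointwise convergence forces convergence of the
   coefficients.  As [f] lies in A_a, for every [b > a] some ratio [p k.+1 / p k] of [f] is
   below [b]; the same then holds for [fs n] with [n] large, and log-concavity propagates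
   it to all larger [k]: this gives boundedness, hence convergence, in A_a.

   For [f] to be a Laguerre function, re-centre at a point [s > 0] with [f s <> 0]: as a
   function of [w = z - s] every factor becomes [1 + t w] with [0 <= t <= 1 / s], where a
   zero at the origin is just [t = 1 / s].  The total weight [alpha + sum_j t_j] is at most
   [|f (s + 1) / f s|], hence bounded along the sequence, so all the [t_j] and the total
   weight converge along an ultrafilter.  Replacing the factors beyond the J-th by an
   exponential of the same weight costs O(1/J) uniformly in [n], so the limit has the same
   form; the weight lost in the limit goes into its exponential factor. *)

Definition cabs (R : realType) (z : CC R) : R := ComplexField.Normc.normc (z : R[i]).
Definition RtoC (R : realType) (x : R) : CC R := (x%:C)%C.

HB.instance Definition _ (R : realType) :=
  GRing.RMorphism.copy (@RtoC R) (real_complex R).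

Section ComplexModulus.
Variable R : realType.
Local Notation C := (CC R).
Implicit Types (x y : R) (z w : C).

Lemma normE z : `|z| = RtoC (cabs z).
Proof. by []. Qed.

Lemma ler_RtoC x y : (RtoC x <= RtoC y) = (x <= y).
Proof. exact: lecR. Qed.

Lemma ltr_RtoC x y : (RtoC x < RtoC y) = (x < y).
Proof. exact: ltcR. Qed.

Lemma RtoC_inj : injective (@RtoC R).
Proof. exact: complexI. Qed.

Lemma cabs_ge0 z : 0 <= cabs z.
Proof. by rewrite -ler_RtoC -normE normr_ge0. Qed.

Lemma cabsM z w : cabs (z * w) = cabs z * cabs w.
Proof. by apply: RtoC_inj; rewrite rmorphM -!normE normrM. Qed.

Lemma cabsN z : cabs (- z) = cabs z.
Proof. by apply: RtoC_inj; rewrite -!normE normrN. Qed.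

Lemma cabs_distC z w : cabs (z - w) = cabs (w - z).
Proof. by rewrite -cabsN opprB. Qed.

Lemma cabsV z : cabs z^-1 = (cabs z)^-1.
Proof. by apply: RtoC_inj; rewrite fmorphV -!normE normfV. Qed.

Lemma cabsX z n : cabs (z ^+ n) = cabs z ^+ n.
Proof. by apply: RtoC_inj; rewrite rmorphXn -!normE normrX. Qed.

Lemma ler_cabsD z w : cabs (z + w) <= cabs z + cabs w.
Proof. by rewrite -ler_RtoC rmorphD -!normE ler_normD. Qed.

Lemma ler_cabsB z w : cabs (z - w) <= cabs z + cabs w.
Proof. by rewrite -(cabsN w) ler_cabsD. Qed.

Lemma cabs_RtoC x : cabs (RtoC x) = `|x|.
Proof. by rewrite /cabs /RtoC /= expr0n addr0 sqrtr_sqr. Qed.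

Lemma ger0_cabs x : 0 <= x -> cabs (RtoC x) = x.
Proof. by rewrite cabs_RtoC => /ger0_norm. Qed.

Lemma cabs_nat n : cabs (n%:R : C) = n%:R.
Proof. by rewrite -(rmorph_nat (@RtoC R)) ger0_cabs. Qed.

Lemma cabs0 : cabs (0 : C) = 0. Proof. exact: cabs_nat 0. Qed.
Lemma cabs1 : cabs (1 : C) = 1. Proof. exact: cabs_nat 1. Qed.

Lemma cabs_eq0 z : (cabs z == 0) = (z == 0).
Proof. by rewrite -[RHS]normr_eq0 normE fmorph_eq0. Qed.

Lemma cabs_gt0 z : (0 < cabs z) = (z != 0).
Proof. by rewrite lt_neqAle eq_sym cabs_eq0 cabs_ge0 andbT. Qed.

Lemma ler_cabs_sum (I : Type) (s : seq I) (P : pred I) (F : I -> C) :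
  cabs (\sum_(i <- s | P i) F i) <= \sum_(i <- s | P i) cabs (F i).
Proof.
apply: (big_ind2 (fun z x => cabs z <= x)) => [|z x w y zx wy|//]; first by rewrite cabs0.
exact: le_trans (ler_cabsD _ _) (lerD zx wy).
Qed.

Lemma norm_Re_le_cabs z : `|complex.Re (z : R[i])| <= cabs z.
Proof. by rewrite -ler_RtoC; exact: normc_ge_Re. Qed.

Lemma norm_Im_le_cabs z : `|complex.Im (z : R[i])| <= cabs z.
Proof.
case: z => a b /=; rewrite /cabs /= -(sqrtr_sqr b) ler_sqrt ?addr_ge0 ?sqr_ge0//.
by rewrite lerDr sqr_ge0.
Qed.

End ComplexModulus.
#[local] Hint Extern 0 (is_true (_ <= cabs _)) => solve [exact: cabs_ge0] : core.

Lemma cvgM_iff (K : numFieldType) (T : Type) (F : set_system T) {FF : Filter F}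
    (u v : T -> K) (l q : K) : q != 0 -> v @ F --> q ->
  u t * v t @[t --> F] --> l * q <-> u @ F --> l.
Proof.
move=> q0 vq; split=> [uvlq|ul]; last exact: cvgM.
rewrite -(mulfK q0 l); apply: cvg_trans (cvgM uvlq (cvgV q0 vq)).
apply: near_eq_cvg.
by move: vq => /cvgr_neq0/(_ q0); apply: filterS => t vt0 /=; rewrite mulfK.
Qed.

Section ComplexLimits.
Variable R : realType.
Local Notation C := (CC R).
Variables (T : Type) (F : set_system T).
Implicit Types (u : T -> C) (l : C).

Lemma cvg_cabsP u l {FF : Filter F} : u @ F --> l <-> cabs (u t - l) @[t --> F] --> 0.
Proof.
split=> [/cvgrPdist_lt ul|/cvgr0Pnorm_lt ul].
  apply/cvgr0Pnorm_lt => e e0.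
  have : (0 : C) < RtoC e by rewrite ltr_RtoC.
  move=> /ul; apply: filterS => t; rewrite normE ltr_RtoC cabs_distC.
  by rewrite ger0_norm.
apply/cvgrPdist_lt => e e0.
have eE : RtoC (complex.Re (e : R[i])) = e := RRe_real (gtr0_real e0).
have : 0 < complex.Re (e : R[i]) by rewrite -ltr_RtoC eE.
move=> /ul; apply: filterS => t.
by rewrite ger0_norm // cabs_distC -ltr_RtoC eE.
Qed.

Lemma squeeze_cabs u (v : T -> R) l {FF : Filter F} :
  (\forall t \near F, cabs (u t - l) <= v t) -> v @ F --> 0 -> u @ F --> l.
Proof.
move=> uv v0; apply/cvg_cabsP; apply: (squeeze_cvgr _ (cvg_cst 0) v0).
by apply: filterS uv => t ->; rewrite cabs_ge0.
Qed.

Lemma cvg_cabs u l {FF : Filter F} : u @ F --> l -> cabs (u t) @[t --> F] --> cabs l.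
Proof.
move=> /cvg_cabsP/cvgr0Pnorm_lt ul; apply/cvgrPdist_lt => e /ul.
apply: filterS => t; apply: le_lt_trans; rewrite (ger0_norm (cabs_ge0 _)) ler_norml.
have := ler_cabsD (u t - l) l; have := ler_cabsD (l - u t) (u t).
by rewrite !subrK cabs_distC; lra.
Qed.

Lemma cvg_RtoC (u : T -> R) (l : R) {FF : Filter F} :
  u @ F --> l -> RtoC (u t) @[t --> F] --> RtoC l.
Proof.
move=> ul; apply/cvg_cabsP; under eq_fun do rewrite -rmorphB cabs_RtoC.
by rewrite -(normr0 R) -(subrr l); exact: cvg_norm (cvgB ul (cvg_cst l)).
Qed.

Lemma cvg_Re u l {FF : Filter F} :
  u @ F --> l -> complex.Re (u t : R[i]) @[t --> F] --> complex.Re (l : R[i]).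
Proof.
move=> /cvg_cabsP/cvgr0Pnorm_lt ul; apply/cvgrPdist_lt => e /ul.
apply: filterS => t; apply: le_lt_trans; rewrite (ger0_norm (cabs_ge0 _)) distrC.
by rewrite -(raddfB (@complex.Re R : Rcomplex R -> R)) norm_Re_le_cabs.
Qed.

Lemma cvg_ReIm u (a b : R) {FF : Filter F} :
  complex.Re (u t : R[i]) @[t --> F] --> a ->
  complex.Im (u t : R[i]) @[t --> F] --> b ->
  u @ F --> RtoC a + RtoC b * ('i%C : C).
Proof.
move=> ua ub; have -> : u = fun t => RtoC (complex.Re (u t : R[i])) +
    RtoC (complex.Im (u t : R[i])) * ('i%C : C).
  by apply/funext => t; rewrite [LHS]complexE mulrC.
exact: cvgD (cvg_RtoC ua) (cvgM (cvg_RtoC ub) (cvg_cst _)).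
Qed.

Lemma cabs_lim_le u l (M : R) {FF : ProperFilter F} :
  u @ F --> l -> (\forall t \near F, cabs (u t) <= M) -> cabs l <= M.
Proof. by move=> /cvg_cabs; exact: cvgr_to_le. Qed.

Lemma cvgC_unique u l l' {FF : ProperFilter F} : u @ F --> l -> u @ F --> l' -> l = l'.
Proof. exact: (cvg_unique (@norm_hausdorff _ C)). Qed.

End ComplexLimits.

Section UltrafilterLimits.
Variable R : realType.
Local Notation C := (CC R).
Variable T : Type.

Lemma cvg_from_ultra (V : topologicalType) (F : set_system T) {FF : Filter F}
    (u : T -> V) (l : V) :
  (forall G, UltraFilter G -> F `<=` G -> u @ G --> l) -> u @ F --> l.
Proof.
move=> ul A lA; apply: contrapT => nFA.
have properW : ProperFilter (within (~` (u @^-1` A)) F).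
  split; last exact: within_filter.
  rewrite /within /= => FA; apply: nFA; move: FA.
  by apply: filterS => t nAt; exact: contrapT.
have [G [ultraG WG]] := ultraFilterLemma properW.
have GA : G (u @^-1` A) by apply: (ul G ultraG _ A lA); exact: subset_trans (cvg_within _) WG.
have GnA : G (~` (u @^-1` A)) := WG _ (withinT _ FF).
by apply: (@filter_not_empty _ G _); rewrite -(setICr (u @^-1` A)); exact: filterI.
Qed.

Lemma ultra_bounded_cvg (U : set_system T) {UU : UltraFilter U} (u : T -> R) (B : R) :
  (\forall t \near U, `|u t| <= B) -> exists l : R, u @ U --> l.
Proof.
move=> uB; have [|l [_ lcl]] := @segment_compact R (- B) B (u @ U) _.
  by apply: filterS uB => t; rewrite /= in_itv /= ler_norml.
exists l => V /= lV; have [//|UnV] := in_ultra_setVsetC (u @^-1` V) UU.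
by have [y [/= nVy Vy]] := lcl (~` V) V UnV lV.
Qed.

Lemma ultra_bounded_cvgC (U : set_system T) {UU : UltraFilter U} (u : T -> C) (B : R) :
  (\forall t \near U, cabs (u t) <= B) -> exists l : C, u @ U --> l.
Proof.
move=> uB.
have [|a ua] := @ultra_bounded_cvg U UU (fun t => complex.Re (u t : R[i])) B.
  by apply: filterS uB => t; exact/le_trans/norm_Re_le_cabs.
have [|b ub] := @ultra_bounded_cvg U UU (fun t => complex.Im (u t : R[i])) B.
  by apply: filterS uB => t; exact/le_trans/norm_Im_le_cabs.
by exists (RtoC a + RtoC b * ('i%C : C)); exact: cvg_ReIm.
Qed.

End UltrafilterLimits.

Section DominatedSums.
Variable R : realType.
Local Notation C := (CC R).
Variables (u : nat -> C) (M q : R).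
Hypotheses (q_ge0 : 0 <= q) (q_lt1 : q < 1).
Hypothesis u_le : forall k, cabs (u k) <= M * q ^+ k.

Let M_ge0 : 0 <= M.
Proof. by have := le_trans (cabs_ge0 _) (u_le 0); rewrite mulr1. Qed.

Lemma dominated_sum_le N n : (N <= n)%N ->
  cabs (\sum_(k < n) u k - \sum_(k < N) u k) <= M * q ^+ N / (1 - q).
Proof.
have q1 : 0 < 1 - q by rewrite subr_gt0.
move=> /subnKC <-; move: (n - N)%N => m.
suff : cabs (\sum_(k < N + m) u k - \sum_(k < N) u k) <=
    M * q ^+ N / (1 - q) - M * q ^+ (N + m) / (1 - q).
  move/le_trans; apply.
  by rewrite lerBlDr lerDl divr_ge0 ?mulr_ge0 ?exprn_ge0 // ltW.
elim: m => [|m IH]; first by rewrite addn0 !subrr cabs0.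
rewrite addnS big_ord_recr /= addrAC.
apply: le_trans (ler_cabsD _ _) _; apply: le_trans (lerD IH (u_le _)) _.
rewrite le_eqVlt; apply/orP; left; apply/eqP; rewrite exprS.
by field; rewrite gt_eqF.
Qed.

Lemma cvg_dominated_sum : exists s : C, (fun N => \sum_(k < N) u k) @ \oo --> s.
Proof.
have cvg_component (v : nat -> R) : (forall k, `|v k| <= cabs (u k)) ->
    exists s : R, (fun N => \sum_(k < N) v k) @ \oo --> s.
  move=> vu; suff /cvg_ex[s vs] : cvgn (series v) by exists s; move: vs; rewrite seriesEord.
  apply: normed_cvg; apply: (@series_le_cvg _ _ (geometric M q)) => [n|n|n|] /=.
  - exact: normr_ge0.
  - exact: le_trans (u_le n).
  - exact: le_trans (vu n) (u_le n).
  - by apply: is_cvg_geometric_series; rewrite ger0_norm.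
have [a ua] := cvg_component _ (fun k => norm_Re_le_cabs (u k)).
have [b ub] := cvg_component _ (fun k => norm_Im_le_cabs (u k)).
exists (RtoC a + RtoC b * ('i%C : C)); apply: cvg_ReIm.
  rewrite [X in X @ _](_ : _ = fun N => \sum_(k < N) complex.Re (u k : R[i])) //.
  by apply/funext => N; exact: (raddf_sum (@complex.Re R : Rcomplex R -> R)).
rewrite [X in X @ _](_ : _ = fun N => \sum_(k < N) complex.Im (u k : R[i])) //.
by apply/funext => N; exact: (raddf_sum (@complex.Im R : Rcomplex R -> R)).
Qed.

Lemma dominated_sum_tail s : (fun N => \sum_(k < N) u k) @ \oo --> s ->
  forall N, cabs (s - \sum_(k < N) u k) <= M * q ^+ N / (1 - q).
Proof.
move=> us N; apply: cabs_lim_le (cvgB us (cvg_cst _)) _; near=> n.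
by apply: dominated_sum_le; near: n; exact: nbhs_infty_ge.
Unshelve. all: by end_near. Qed.

End DominatedSums.

Section EntireSeries.
Variable R : realType.
Local Notation C := (CC R).
Implicit Types (c d : nat -> C) (f g : C -> C) (z : C) (r M : R).

Let half_ge0 : 0 <= 2^-1 :> R. Proof. lra. Qed.
Let half_lt1 : 2^-1 < 1 :> R. Proof. lra. Qed.

Definition entire_coef c := forall r, 0 <= r -> exists M, forall k, cabs (c k) * r ^+ k <= M.

Definition is_pseries c f :=
  entire_coef c /\ forall z, (fun N => \sum_(k < N) c k * z ^+ k) @ \oo --> f z.

Lemma pseries_term_le c k z r M : cabs (c k) * (2 * r) ^+ k <= M ->
  cabs z <= r -> cabs (c k * z ^+ k) <= M * 2^-1 ^+ k.
Proof.
move=> cM zr; rewrite exprVn ler_pdivlMr ?exprn_gt0 // cabsM cabsX.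
apply: le_trans cM; rewrite exprMn -mulrA ler_wpM2l // mulrC.
by rewrite ler_wpM2l ?exprn_ge0 // lerXn2r ?nnegrE // (le_trans _ zr).
Qed.

Lemma pseries_tail_le c f r M : is_pseries c f -> (forall k, cabs (c k) * (2 * r) ^+ k <= M) ->
  forall z N, cabs z <= r -> cabs (f z - \sum_(k < N) c k * z ^+ k) <= 2 * M * 2^-1 ^+ N.
Proof.
move=> [_ cf] cM z N zr.
have term_le k := pseries_term_le (cM k) zr.
have := dominated_sum_tail half_ge0 half_lt1 term_le (cf z) N.
have -> : 1 - 2^-1 = 2^-1 :> R by lra.
by rewrite invrK mulrC mulrA.
Qed.

Lemma entire_coef_pseries c : entire_coef c -> exists f, is_pseries c f.
Proof.
move=> cE; suff /choice[f cf] : forall z, exists s : C,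
    (fun N => \sum_(k < N) c k * z ^+ k) @ \oo --> s by exists f.
move=> z; have [|M cM] := cE (2 * cabs z); first by rewrite mulr_ge0.
apply: (@cvg_dominated_sum _ (fun k => c k * z ^+ k) M _ half_ge0 half_lt1) => k.
exact: pseries_term_le (cM k) (lexx _).
Qed.

Lemma pseries_at0 c f : is_pseries c f -> f 0 = c 0%N.
Proof.
move=> [_ /(_ 0)]; rewrite -cvg_shiftS => /cvgC_unique; apply.
apply: cvg_near_cst; apply: nearW => n.
rewrite /= big_ord_recl expr0 mulr1 big1 ?addr0 // => i _.
by rewrite lift0 exprS mul0r mulr0.
Qed.

Lemma pseries_coef_neq0 c f z : is_pseries c f -> f z != 0 -> exists k, c k != 0.
Proof.
move=> [_ cf] /eqP fz0; apply: contrapT => nex; apply: fz0.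
apply: cvgC_unique (cf z) _; apply: cvg_near_cst; apply: nearW => N.
rewrite big1 // => k _; have [->|ck] := eqVneq (c k) 0; first by rewrite mul0r.
by case: nex; exists k.
Qed.

Lemma pseriesD c d f g : is_pseries c f -> is_pseries d g ->
  is_pseries (fun k => c k + d k) (fun z => f z + g z).
Proof.
move=> [cE cf] [dE dg]; split=> [r r0|z].
  have [M cM] := cE r r0; have [M' dM] := dE r r0.
  exists (M + M') => k; apply: le_trans (lerD (cM k) (dM k)).
  by rewrite -mulrDl ler_wpM2r ?exprn_ge0 // ler_cabsD.
under eq_fun do under eq_bigr do rewrite mulrDl.
by under eq_fun do rewrite big_split /=; exact: cvgD.
Qed.

Lemma pseriesZ c f (a : C) : is_pseries c f ->
  is_pseries (fun k => a * c k) (fun z => a * f z).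
Proof.
move=> [cE cf]; split=> [r r0|z].
  have [M cM] := cE r r0; exists (cabs a * M) => k.
  by rewrite cabsM -mulrA ler_wpM2l.
under eq_fun do under eq_bigr do rewrite -mulrA.
by under eq_fun do rewrite -mulr_sumr; exact: cvgM (cvg_cst _) (cf z).
Qed.

Lemma pseriesB c d f g : is_pseries c f -> is_pseries d g ->
  is_pseries (fun k => c k - d k) (fun z => f z - g z).
Proof.
move=> cf /(pseriesZ (-1)) /(pseriesD cf).
by congr is_pseries; apply/funext => x; rewrite mulN1r.
Qed.

Lemma pseries_dilate c f (a : C) : is_pseries c f ->
  is_pseries (fun k => c k * a ^+ k) (fun z => f (a * z)).
Proof.
move=> [cE cf]; split=> [r r0|z].
  have [|M cM] := cE (cabs a * r); first by rewrite mulr_ge0.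
  by exists M => k; rewrite cabsM cabsX -mulrA -exprMn.
by under eq_fun do under eq_bigr do rewrite -mulrA -exprMn; exact: cf.
Qed.

Lemma pseriesMX c f : is_pseries c f ->
  is_pseries (fun k => if k is k'.+1 then c k' else 0) (fun z => z * f z).
Proof.
move=> [cE cf]; split=> [r r0|z].
  have [M cM] := cE r r0; exists (r * M) => -[|k].
    by rewrite cabs0 mul0r mulr_ge0 //; apply: le_trans (cM 0); rewrite mulr_ge0.
  by rewrite exprS mulrCA ler_wpM2l.
rewrite -cvg_shiftS /=.
rewrite [X in X @ _](_ : _ = fun N => z * \sum_(k < N) c k * z ^+ k).
  exact: cvgM (cvg_cst _) (cf z).
apply/funext => N; rewrite big_ord_recl mul0r add0r mulr_sumr.
by apply: eq_bigr => k _; rewrite lift0 exprS mulrCA.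
Qed.

End EntireSeries.

Lemma fact_neq0 (K : numFieldType) n : n`!%:R != 0 :> K.
Proof. by rewrite pnatr_eq0 -lt0n fact_gt0. Qed.

Section EntireSeriesDerivative.
Variable R : realType.
Local Notation C := (CC R).
Local Notation K := (R[i] : numFieldType).
Implicit Types (c : nat -> C) (f g : C -> C) (z h : C) (M : R).

Definition diff_coef c : nat -> C := fun k => k.+1%:R * c k.+1.

Lemma entire_diff_coef c : entire_coef c -> entire_coef (diff_coef c).
Proof.
move=> cE r r0; have [|M cM] := cE (2 * (r + 1)); first by lra.
exists M => k; apply: le_trans (cM k.+1).
rewrite cabsM cabs_nat mulrAC mulrC ler_wpM2l // exprMn.
apply: ler_pM; rewrite ?exprn_ge0 //; first by rewrite -natrX ler_nat ltnW // ltn_expl.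
apply: (@le_trans _ _ ((r + 1) ^+ k)); first by rewrite lerXn2r ?nnegrE //; lra.
by rewrite ler_weXn2l //; lra.
Qed.

Lemma cvg_diff_coef_sum c g z : is_pseries (diff_coef c) g ->
  (fun N => \sum_(k < N) c k * (k%:R * z ^+ k.-1)) @ \oo --> g z.
Proof.
move=> [_ /(_ z) dg]; rewrite -cvg_shiftS.
rewrite [X in X @ _](_ : _ = fun N => \sum_(k < N) diff_coef c k * z ^+ k) //.
apply/funext => N; rewrite /= big_ord_recl mul0r mulr0 add0r.
by apply: eq_bigr => k _; rewrite lift0 /diff_coef mulrCA mulrA.
Qed.

Lemma cabs_exprD_taylor0 z h k : cabs h <= 1 ->
  cabs ((h + z) ^+ k - z ^+ k) <= cabs h * (cabs z + 1) ^+ k.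
Proof.
move=> h1; elim: k => [|k IH]; first by rewrite !expr0 subrr cabs0 mulr1.
have -> : (h + z) ^+ k.+1 - z ^+ k.+1 = z * ((h + z) ^+ k - z ^+ k) + h * (h + z) ^+ k.
  by rewrite !exprS; ring.
apply: le_trans (ler_cabsD _ _) _; rewrite !cabsM cabsX.
have := ler_wpM2l (cabs_ge0 z) IH; rewrite exprS.
have : cabs (h + z) ^+ k <= (cabs z + 1) ^+ k.
  rewrite lerXn2r ?nnegrE ?addr_ge0 //.
  by apply: le_trans (ler_cabsD _ _) _; lra.
move/(ler_wpM2l (cabs_ge0 h)); lra.
Qed.

Lemma cabs_exprD_taylor1 z h k : cabs h <= 1 ->
  cabs ((h + z) ^+ k - z ^+ k - h * (k%:R * z ^+ k.-1)) <= cabs h ^+ 2 * (cabs z + 1) ^+ k.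
Proof.
move=> h1; elim: k => [|k IH].
  by rewrite !expr0 !mul0r mulr0 subr0 subrr cabs0 mulr1 exprn_ge0.
have -> : (h + z) ^+ k.+1 - z ^+ k.+1 - h * (k.+1%:R * z ^+ k.+1.-1) =
    z * ((h + z) ^+ k - z ^+ k - h * (k%:R * z ^+ k.-1)) + h * ((h + z) ^+ k - z ^+ k).
  case: k {IH} => [|k] /=; rewrite !exprS ?expr0; first by ring.
  by rewrite -!natr1; ring.
apply: le_trans (ler_cabsD _ _) _; rewrite !cabsM.
have := ler_wpM2l (cabs_ge0 z) IH; rewrite exprS.
have := ler_wpM2l (cabs_ge0 h) (@cabs_exprD_taylor0 z h k h1).
by rewrite [(cabs z + 1) ^+ k.+1]exprS; lra.
Qed.

Lemma pseries_taylor1 c f g z : is_pseries c f -> is_pseries (diff_coef c) g ->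
  exists M, forall h, cabs h <= 1 -> cabs (f (h + z) - f z - h * g z) <= cabs h ^+ 2 * M.
Proof.
move=> [cE cf] dg; have z0 := cabs_ge0 z.
have [|M cM] := cE (2 * (cabs z + 1)); first by lra.
exists (M * 2) => h h1.
pose u k := c k * ((h + z) ^+ k - z ^+ k - h * (k%:R * z ^+ k.-1)).
have u_le k : cabs (u k) <= cabs h ^+ 2 * M * 2^-1 ^+ k.
  rewrite cabsM; apply: le_trans (ler_wpM2l _ (cabs_exprD_taylor1 z k h1)) _ => //.
  rewrite -mulrA mulrCA ler_wpM2l ?exprn_ge0 //.
  by rewrite exprVn ler_pdivlMr ?exprn_gt0 // -mulrA -exprMn [_ * 2]mulrC.
have us : (fun N => \sum_(k < N) u k) @ \oo --> f (h + z) - f z - h * g z.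
  rewrite [X in X @ _](_ : _ = fun N => \sum_(k < N) c k * (h + z) ^+ k
      - \sum_(k < N) c k * z ^+ k - h * \sum_(k < N) c k * (k%:R * z ^+ k.-1)).
    apply: cvgB; first exact: cvgB (cf _) (cf _).
    exact: cvgM (cvg_cst _) (cvg_diff_coef_sum dg).
  by apply/funext => N; rewrite mulr_sumr -!sumrB; apply: eq_bigr => k _; rewrite /u; ring.
have half_ge0 : 0 <= 2^-1 :> R by lra.
have half_lt1 : 2^-1 < 1 :> R by lra.
have := dominated_sum_tail half_ge0 half_lt1 u_le us 0.
have -> : 1 - 2^-1 = 2^-1 :> R by lra.
by rewrite big_ord0 subr0 expr0 mulr1 invrK mulrA.
Qed.

Lemma pseries_difference_quotient c f g z : is_pseries c f -> is_pseries (diff_coef c) g ->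
  h^-1 *: (f (h + z) - f z) @[h --> (0 : K)^'] --> g z.
Proof.
move=> cf dg; have [M fM] := pseries_taylor1 z cf dg.
have cvg_h : cabs (h : C) @[h --> (0 : K)^'] --> (0 : R).
  have : (h : C) @[h --> (0 : K)^'] --> (0 : C) by apply: cvg_within_filter; exact: cvg_id.
  by move=> /cvg_cabs; rewrite cabs0.
have cvg_hM : cabs (h : C) * M @[h --> (0 : K)^'] --> (0 : R).
  by rewrite -[X in _ --> X](mul0r M); exact: cvgM cvg_h (cvg_cst _).
apply: squeeze_cabs cvg_hM; near=> h.
have h0 : h != 0 by near: h; exact: nbhs_dnbhs_neq.
have h1 : cabs (h : C) <= 1 by near: h; apply: (cvgr_le _ cvg_h); exact: ltr01.
have -> : h^-1 *: (f (h + z) - f z) - g z = (h^-1 : C) * (f (h + z) - f z - (h : C) * g z).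
  by rewrite mulrBr mulKf.
rewrite cabsM cabsV ler_pdivrMl ?cabs_gt0 //.
by rewrite mulrA -expr2; exact: fM.
Unshelve. all: by end_near. Qed.

Lemma pseries_derive1 c f : is_pseries c f -> is_pseries (diff_coef c) (derive1 f).
Proof.
move=> cf; have [g dg] := entire_coef_pseries (entire_diff_coef (proj1 cf)).
suff -> : derive1 f = g by [].
apply/funext => z; apply: cvg_lim; first exact: norm_hausdorff.
exact: pseries_difference_quotient cf dg.
Qed.

Lemma pseries_derivable c f z : is_pseries c f -> derivable f z 1.
Proof.
move=> cf; apply/cvg_ex; exists (derive1 f z).
under eq_fun do rewrite [_%:A]mulr1.
exact: pseries_difference_quotient cf (pseries_derive1 cf).
Qed.

Lemma pseries_continuous c f : is_pseries c f -> continuous f.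
Proof.
move=> cf z; apply: differentiable_continuous.
by apply/derivable1_diffP; exact: pseries_derivable cf.
Qed.

Lemma pseries_derive1n0 c f n : is_pseries c f -> derive1n n f 0 = n`!%:R * c n.
Proof.
elim: n c f => [|n IH] c f cf; first by rewrite mul1r; exact: pseries_at0.
by rewrite derive1Sn (IH _ _ (pseries_derive1 cf)) mulrA factS mulnC natrM.
Qed.

Definition taylor_coef f : nat -> C := fun k => derive1n k f 0 / k`!%:R.

Lemma pseries_taylor_coef c f : is_pseries c f -> c = taylor_coef f.
Proof.
move=> cf; apply/funext => k; rewrite /taylor_coef (pseries_derive1n0 k cf).
by rewrite mulrAC divff ?mul1r // fact_neq0.
Qed.

End EntireSeriesDerivative.

Section EntireSeriesLimits.
Variable R : realType.
Local Notation C := (CC R).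
Variables (T : Type) (cs : T -> nat -> C) (fs : T -> C -> C) (f : C -> C).
Hypothesis csfs : forall t, is_pseries (cs t) (fs t).
Hypothesis cs_bounded : forall r, 0 <= r ->
  exists M, forall t k, cabs (cs t k) * r ^+ k <= M.

Lemma pseries_lim (F : set_system T) {FF : ProperFilter F} (c : nat -> C) :
  (forall k, cs t k @[t --> F] --> c k) -> (forall z, fs t z @[t --> F] --> f z) ->
  is_pseries c f.
Proof.
move=> csc fsf; split=> [r r0|z].
  have [M csM] := cs_bounded r0; exists M => k.
  apply: (cvgr_to_le (cvgM (cvg_cabs (csc k)) (cvg_cst (r ^+ k)))).
  by apply: nearW => t; exact: csM.
have [|M csM] := @cs_bounded (2 * cabs z); first by rewrite mulr_ge0.
apply: (@squeeze_cabs _ _ _ _ (geometric (2 * M) 2^-1)); last first.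
  by apply: cvg_geometric; rewrite ger0_norm ?invr_ge0// invf_lt1// ltr1n.
apply: nearW => N; rewrite cabs_distC.
have cvg_sum : \sum_(k < N) cs t k * z ^+ k @[t --> F] --> \sum_(k < N) c k * z ^+ k.
  by apply: cvg_big => [|k _]; [exact: add_continuous|exact: cvgM (csc k) (cvg_cst _)].
apply: cabs_lim_le (cvgB (fsf z) cvg_sum) _; apply: nearW => t.
exact: pseries_tail_le (csfs t) (csM t) _ _ _.
Qed.

(* Along every finer ultrafilter the coefficients converge, and their limits are forced to
   be the Taylor coefficients of [f]; this replaces Montel's theorem and Cauchy's formula. *)
Lemma cvg_pseries_coef (F : set_system T) {FF : ProperFilter F} :
  (forall z, fs t z @[t --> F] --> f z) ->
  is_pseries (taylor_coef f) f /\ forall k, cs t k @[t --> F] --> taylor_coef f k.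
Proof.
move=> fsf.
have coefs_along U : UltraFilter U -> F `<=` U ->
    is_pseries (taylor_coef f) f /\ forall k, cs t k @[t --> U] --> taylor_coef f k.
  move=> ultraU FU.
  have /choice[c csc] : forall k, exists l : C, cs t k @[t --> U] --> l.
    move=> k; have [M csM] := cs_bounded ler01.
    apply: (@ultra_bounded_cvgC _ _ _ _ _ M); apply: nearW => t.
    by have := csM t k; rewrite expr1n mulr1.
  have cf : is_pseries c f.
    by apply: (pseries_lim csc) => z; exact: cvg_trans (cvg_app _ FU) (fsf z).
  by rewrite -(pseries_taylor_coef cf).
split=> [|k]; last by apply: cvg_from_ultra => U /coefs_along UFc /UFc[].
by have [U [/coefs_along UFc /UFc[]]] := ultraFilterLemma FF.
Qed.

End EntireSeriesLimits.

Section NonnegSums.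
Variable R : realType.
Implicit Types (t : nat -> R) (T S : R).

Lemma nondecreasing_nneg_sum t : (forall j, 0 <= t j) ->
  nondecreasing_seq (fun n => \sum_(j < n) t j).
Proof. by move=> t0; apply/nondecreasing_seqP => n; rewrite big_ord_recr /= lerDl. Qed.

Lemma nneg_sum_le_lim t T : (forall j, 0 <= t j) ->
  (fun n => \sum_(j < n) t j) @ \oo --> T -> forall n, \sum_(j < n) t j <= T.
Proof.
move=> /nondecreasing_nneg_sum nd tT n.
by rewrite -(cvg_lim (@norm_hausdorff _ _) tT) nondecreasing_cvgn_le //; apply/cvg_ex; exists T.
Qed.

Lemma cvg_nneg_sum t S : (forall j, 0 <= t j) -> (forall n, \sum_(j < n) t j <= S) ->
  exists2 T, T <= S & (fun n => \sum_(j < n) t j) @ \oo --> T.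
Proof.
move=> t0 tS; have /cvg_ex[T tT] : cvgn (fun n => \sum_(j < n) t j).
  apply: nondecreasing_is_cvgn; first exact: nondecreasing_nneg_sum.
  by exists S => _ [n _ <-].
by exists T => //; apply: (cvgr_to_le tT); exact: nearW.
Qed.

End NonnegSums.

Local Notation exp_sum x N := (\sum_(k < N) x ^+ k / k`!%:R).

Section ExponentialSums.
Variable K : numFieldType.
Implicit Types x y : K.

Lemma sum_antidiagonals (G : nat -> nat -> K) N :
  \sum_(k < N) \sum_(i < k.+1) G i (k - i)%N = \sum_(i < N) \sum_(j < N - i) G i j.
Proof.
elim: N => [|N IH]; first by rewrite !big_ord0.
rewrite big_ord_recr /= IH [in RHS]big_ord_recr /= subSnn big_ord1.
rewrite big_ord_recr /= subnn addrA; congr (_ + _); rewrite -big_split /=.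
by apply: eq_bigr => i _; rewrite subSn 1?ltnW // big_ord_recr.
Qed.

Lemma exprD_fact x y k : (x + y) ^+ k / k`!%:R =
  \sum_(i < k.+1) (x ^+ i / i`!%:R) * (y ^+ (k - i) / (k - i)`!%:R).
Proof.
rewrite addrC exprDn mulr_suml; apply: eq_bigr => -[i /=]; rewrite ltnS => ik _.
rewrite -(bin_fact ik) !natrM -mulr_natr.
have C0 : 'C(k, i)%:R != 0 :> K by rewrite pnatr_eq0 -lt0n bin_gt0.
by rewrite !invfM -!mulrA mulVKf //; ring.
Qed.

Lemma exp_sumM x y N : exp_sum x N * exp_sum y N - exp_sum (x + y) N =
  \sum_(i < N) x ^+ i / i`!%:R * (exp_sum y N - exp_sum y (N - i)).
Proof.
under [X in _ - X]eq_bigr do rewrite exprD_fact.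
rewrite (sum_antidiagonals (fun i j => x ^+ i / i`!%:R * (y ^+ j / j`!%:R))).
rewrite mulr_suml -sumrB; apply: eq_bigr => i _.
by rewrite mulrBr -[X in _ - X]mulr_sumr.
Qed.

End ExponentialSums.

Section ComplexExponential.
Variable R : realType.
Local Notation C := (CC R).
Implicit Types (z w : C) (x : R).

Lemma cvg_exp_sum x : (fun N => exp_sum x N) @ \oo --> expR x.
Proof.
have : series (exp_coeff x) @ \oo --> expR x by exact: is_cvg_series_exp_coeff.
by rewrite seriesEord.
Qed.
Arguments cvg_exp_sum : clear implicits.

Lemma exp_sum_le x N : 0 <= x -> exp_sum x N <= expR x.
Proof.
move=> x0; apply: (@nneg_sum_le_lim _ (fun k => x ^+ k / k`!%:R) _ _ (cvg_exp_sum x)) => k.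
exact: exp_coeff_ge0.
Qed.

Lemma exp_term_le x k : 0 <= x -> x ^+ k / k`!%:R <= expR x.
Proof.
move=> x0; case: k => [|k]; first by rewrite expr0 divr1 -expR0 ler_expR.
by apply: le_trans (expR_ge1Dxn k x0); rewrite lerDr.
Qed.

Lemma cabs_exp_term z k : cabs (z ^+ k / k`!%:R) = cabs z ^+ k / k`!%:R.
Proof. by rewrite cabsM cabsX cabsV cabs_nat. Qed.

Lemma pseries_cexp : is_pseries (fun k => k`!%:R^-1) (@cexp R).
Proof.
have [|f cf] := @entire_coef_pseries R (fun k => k`!%:R^-1).
  move=> r r0; exists (expR r) => k; apply: le_trans (exp_term_le k r0).
  by rewrite cabsV cabs_nat mulrC.
suff -> : @cexp R = f by [].
apply/funext => z; apply: cvg_lim; first exact: norm_hausdorff.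
have := proj2 cf z; rewrite seriesEord.
by under eq_fun do under eq_bigr do rewrite mulrC.
Qed.

Lemma cvg_cexp_sum z : (fun N => exp_sum z N) @ \oo --> cexp z.
Proof.
have := proj2 pseries_cexp z.
by under eq_fun do under eq_bigr do rewrite mulrC.
Qed.
Arguments cvg_cexp_sum : clear implicits.

Lemma cabs_exp_sumB z M N : (M <= N)%N ->
  cabs (exp_sum z N - exp_sum z M) <= exp_sum (cabs z) N - exp_sum (cabs z) M.
Proof.
move=> /subnKC <-; rewrite !big_split_ord /= ![_ + _ - _]addrAC !subrr !add0r.
apply: le_trans (ler_cabs_sum _ _ _) _; apply: ler_sum => k _.
by rewrite cabs_exp_term.
Qed.

Lemma cabs_cexp z : cabs (cexp z) <= expR (cabs z).
Proof.
apply: cabs_lim_le (cvg_cexp_sum z) _; apply: nearW => N.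
apply: le_trans (exp_sum_le N (cabs_ge0 z)).
by have := cabs_exp_sumB z (leq0n N); rewrite !big_ord0 !subr0.
Qed.

Lemma cexpD z w : cexp (z + w) = cexp z * cexp w.
Proof.
have cvgC : (fun N => exp_sum z N * exp_sum w N - exp_sum (z + w) N) @ \oo -->
    cexp z * cexp w - cexp (z + w).
  exact: cvgB (cvgM (cvg_cexp_sum z) (cvg_cexp_sum w)) (cvg_cexp_sum _).
have cvgR : (fun N => exp_sum (cabs z) N * exp_sum (cabs w) N
    - exp_sum (cabs z + cabs w) N) @ \oo --> (0 : R).
  rewrite -[X in _ --> X](subrr (expR (cabs z + cabs w))) {1}expRD.
  exact: cvgB (cvgM (cvg_exp_sum _) (cvg_exp_sum _)) (cvg_exp_sum _).
apply/esym/eqP; rewrite -subr_eq0; apply/eqP; apply: cvgC_unique cvgC _.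
apply: squeeze_cabs cvgR; apply: nearW => N; rewrite subr0 !exp_sumM.
apply: le_trans (ler_cabs_sum _ _ _) _; apply: ler_sum => i _.
rewrite cabsM cabs_exp_term ler_wpM2l ?divr_ge0 ?exprn_ge0 //.
by apply: cabs_exp_sumB; exact: leq_subr.
Qed.

Lemma cexp0 : cexp (0 : C) = 1.
Proof. by rewrite (pseries_at0 pseries_cexp) invr1. Qed.

Lemma cexp_RtoC x : cexp (RtoC x) = RtoC (expR x).
Proof.
apply: cvgC_unique (cvg_cexp_sum _) _; rewrite [X in X @ _](_ : _ = fun N => RtoC (exp_sum x N)).
  exact: cvg_RtoC (cvg_exp_sum x).
apply/funext => N; rewrite rmorph_sum; apply: eq_bigr => k _.
by rewrite rmorphM rmorphXn fmorphV rmorph_nat.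
Qed.

Lemma cabs_cexp_taylor1 z : cabs (cexp z - (1 + z)) <= cabs z ^+ 2 * expR (cabs z).
Proof.
have exp_sum2 : exp_sum z 2 = 1 + z.
  by rewrite big_ord_recl big_ord1 expr0 expr1 !divr1.
have : (fun N => exp_sum z (N + 2) - (1 + z)) @ \oo --> cexp z - (1 + z).
  apply: cvgB (cvg_cst _); rewrite (cvg_shiftn 2 (fun N => exp_sum z N)).
  exact: cvg_cexp_sum.
move=> /cabs_lim_le; apply; apply: nearW => N.
rewrite -exp_sum2; apply: le_trans (cabs_exp_sumB _ (leq_addl _ _)) _.
rewrite addnC big_split_ord /= addrAC subrr add0r.
apply: le_trans (ler_wpM2l _ (exp_sum_le N (cabs_ge0 z))); last by rewrite exprn_ge0.
rewrite mulr_sumr; apply: ler_sum => i _; rewrite mulrA -exprD.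
rewrite ler_wpM2l ?exprn_ge0 // lef_pV2 ?posrE ?ltr0n ?fact_gt0 // ler_nat.
by rewrite !factS mulnA leq_pmull // muln_gt0.
Qed.

Lemma cvg_cexp (T : Type) (F : set_system T) {FF : Filter F} (u : T -> C) (l : C) :
  u @ F --> l -> cexp (u t) @[t --> F] --> cexp l.
Proof.
move=> ul; apply: continuous_cvg ul; apply: pseries_continuous; exact: pseries_cexp.
Qed.

End ComplexExponential.

Section LogConcave.
Variable R : realType.
Implicit Types (p : nat -> R) (s b : R).

(* Requiring the inequality for all [i <= j], not just for [i = j], excludes internal zeros. *)
Definition log_concave p := (forall k, 0 <= p k) /\
  forall i j, (i <= j)%N -> p i * p j.+1 <= p i.+1 * p j.

(* If [p k] is the k-th derivative of [f] at 0, this is that of [z * f z]. *)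
Definition derivs_mulX p : nat -> R := fun k => k%:R * p k.-1.

Lemma log_concave_exp s : 0 <= s -> log_concave (GRing.exp s).
Proof.
by move=> s0; split=> [k|i j _]; [exact: exprn_ge0|rewrite -!exprD addSnnS].
Qed.

Lemma log_concaveZ s p : 0 <= s -> log_concave p -> log_concave (fun k => s * p k).
Proof.
move=> s0 [p0 pL]; split=> [k|i j ij]; first by rewrite mulr_ge0.
by rewrite mulrACA [leRHS]mulrACA ler_wpM2l ?mulr_ge0 ?pL.
Qed.

Lemma log_concave_derivs_mulX p : log_concave p -> log_concave (derivs_mulX p).
Proof.
move=> [p0 pL]; split=> [k|[|i] j ij]; first by rewrite mulr_ge0.
  by rewrite /derivs_mulX !mul0r !mulr_ge0.
case: j ij => [//|j] ij; rewrite /derivs_mulX mulrACA [leRHS]mulrACA.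
by apply: ler_pM; rewrite ?mulr_ge0 ?pL // -!natrM ler_nat; nia.
Qed.

Lemma log_concave_cross p i j : log_concave p -> (i <= j)%N ->
  p i * derivs_mulX p j.+1 + derivs_mulX p i * p j.+1 <=
  p i.+1 * derivs_mulX p j + derivs_mulX p i.+1 * p j.
Proof.
move=> [p0 pL]; rewrite /derivs_mulX /=; case: i => [|i] ij.
  rewrite mul0r mul0r addr0; case: j ij => [|j] ij; first by rewrite mul0r mulr0 add0r; lra.
  have := ler_wpM2l (ler0n R j.+1) (pL 0 j isT); rewrite -!natr1 /=; lra.
case: j ij => [//|j]; rewrite leq_eqVlt => /orP[/eqP[->]|ij] /=; first by lra.
have outer_le_mid := pL i.+1 j ij.
have inner_le := le_trans (pL i j.+1 (leqW (ltnW ij))) outer_le_mid.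
have ji : 0 <= j.+1%:R - i.+1%:R :> R by rewrite subr_ge0 ler_nat ltnW.
have := ler_wpM2l ji outer_le_mid; have := ler_wpM2l (ler0n R i.+1) inner_le.
rewrite -(natr1 i.+1) -(natr1 j.+1); lra.
Qed.

Lemma log_concave_mul_linear s b p : 0 <= s -> 0 <= b -> log_concave p ->
  log_concave (fun k => s * p k + b * derivs_mulX p k).
Proof.
move=> s0 b0 pL; have qL := log_concave_derivs_mulX pL.
split=> [k|i j ij]; first by rewrite addr_ge0 ?mulr_ge0 ?(proj1 pL) ?(proj1 qL).
have := ler_wpM2l (mulr_ge0 s0 s0) (proj2 pL i j ij).
have := ler_wpM2l (mulr_ge0 s0 b0) (log_concave_cross pL ij).
have := ler_wpM2l (mulr_ge0 b0 b0) (proj2 qL i j ij).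
move: (derivs_mulX p) => q; lra.
Qed.

Lemma log_concave_lim (ps : nat -> nat -> R) p : (forall n, log_concave (ps n)) ->
  (forall k, ps n k @[n --> \oo] --> p k) -> log_concave p.
Proof.
move=> psL cp; split=> [k|i j ij].
  by apply: (cvgr_to_ge (cp k)); apply: nearW => n; case: (psL n).
apply: (ler_cvg_to (cvgM (cp i) (cp j.+1)) (cvgM (cp i.+1) (cp j))).
by apply: nearW => n; have [_] := psL n; exact.
Qed.

End LogConcave.

Section NonnegSeries.
Variable R : realType.
Local Notation C := (CC R).
Variables (c : nat -> R) (f : C -> C).
Hypothesis c_ge0 : forall k, 0 <= c k.
Hypothesis cf : is_pseries (fun k => RtoC (c k)) f.

Lemma nneg_pseries_sum_le (r : R) N : 0 <= r ->
  \sum_(k < N) c k * r ^+ k <= cabs (f (RtoC r)).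
Proof.
move=> r0; have term_ge0 k : 0 <= c k * r ^+ k by rewrite mulr_ge0 ?exprn_ge0.
apply: (@nneg_sum_le_lim _ (fun k => c k * r ^+ k)) => //.
rewrite [X in X @ _](_ : _ = fun n => cabs (\sum_(k < n) RtoC (c k) * RtoC r ^+ k)).
  exact: cvg_cabs (proj2 cf (RtoC r)).
apply/funext => n; rewrite -[LHS]ger0_cabs ?sumr_ge0 // rmorph_sum; congr cabs.
by apply: eq_bigr => k _; rewrite rmorphM rmorphXn.
Qed.

Lemma nneg_pseries_coef_le (r : R) k : 0 <= r -> c k * r ^+ k <= cabs (f (RtoC r)).
Proof.
move=> r0; apply: le_trans (nneg_pseries_sum_le k.+1 r0).
by rewrite big_ord_recr /= lerDr sumr_ge0 // => i _; rewrite mulr_ge0 ?exprn_ge0.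
Qed.

Lemma nneg_pseries_max_modulus (r : R) (z : C) : cabs z <= r ->
  cabs (f z) <= cabs (f (RtoC r)).
Proof.
move=> zr; have r0 : 0 <= r := le_trans (cabs_ge0 z) zr.
apply: cabs_lim_le (proj2 cf z) _; apply: nearW => N.
apply: le_trans (nneg_pseries_sum_le N r0).
apply: le_trans (ler_cabs_sum _ _ _) _; apply: ler_sum => k _.
by rewrite cabsM cabsX ger0_cabs // ler_wpM2l // lerXn2r ?nnegrE.
Qed.

End NonnegSeries.

Lemma cvg_bounded_above (R : realType) (u : nat -> R) (l : R) :
  u @ \oo --> l -> exists M, forall n, u n <= M.
Proof.
move=> ul; have /cvg_has_ub[M uM] : cvgn u by apply/cvg_ex; exists l.
by exists M => n; apply: le_trans (ler_norm _) (uM _ _); exists n.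
Qed.

Section LogConcaveSeries.
Variable R : realType.
Local Notation C := (CC R).
Implicit Types (f g : C -> C) (t : nat -> R) (s b alpha : R) (w : C).

Definition log_concave_series f :=
  exists2 p, log_concave p & is_pseries (fun k => RtoC (p k / k`!%:R)) f.

Lemma log_concave_series_mul_linear s b f : 0 <= s -> 0 <= b ->
  log_concave_series f -> log_concave_series (fun z => (RtoC s + RtoC b * z) * f z).
Proof.
move=> s0 b0 [p pL pf]; exists (fun k => s * p k + b * derivs_mulX p k).
  exact: log_concave_mul_linear.
have := pseriesD (pseriesZ (RtoC s) pf) (pseriesZ (RtoC b) (pseriesMX pf)).
congr is_pseries; apply/funext => k; last by rewrite mulrDl mulrA.
rewrite mulrDl -!mulrA rmorphD; congr (_ + _); rewrite [RHS]rmorphM //; congr (_ * _).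
rewrite /derivs_mulX; case: k => [|k]; first by rewrite !mul0r rmorph0.
by rewrite factS natrM invfM mulrCA mulVKf // pnatr_eq0.
Qed.

Definition lag_prod alpha t N w : C := cexp (RtoC alpha * w) * \prod_(j < N) (1 + RtoC (t j) * w).

Lemma lag_prodS alpha t N w :
  lag_prod alpha t N.+1 w = (1 + RtoC (t N) * w) * lag_prod alpha t N w.
Proof. by rewrite /lag_prod big_ord_recr /= mulrA mulrC. Qed.

Lemma log_concave_lag_prod alpha t l N : 0 <= alpha -> (forall j, 0 <= t j) ->
  log_concave_series (fun z => z ^+ l * lag_prod alpha t N z).
Proof.
move=> a0 t0; elim: l => [|l /(log_concave_series_mul_linear (lexx 0) ler01)]; last first.
  by congr log_concave_series; apply/funext => z; rewrite rmorph0 rmorph1 exprS; ring.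
elim: N => [|N /(log_concave_series_mul_linear ler01 (t0 N))]; last first.
  by congr log_concave_series; apply/funext => z; rewrite rmorph1 lag_prodS !mul1r.
exists (GRing.exp alpha); first exact: log_concave_exp.
have := pseries_dilate (RtoC alpha) (@pseries_cexp R); congr is_pseries; apply/funext => k.
  by rewrite rmorphM rmorphXn fmorphV rmorph_nat mulrC.
by rewrite /lag_prod big_ord0 mul1r mulr1.
Qed.

Lemma log_concave_series_lim (fs : nat -> C -> C) f :
  (forall n, log_concave_series (fs n)) -> (forall z, fs n z @[n --> \oo] --> f z) ->
  log_concave_series f.
Proof.
move=> fsL fsf.
have /choice[p pP] : forall n, exists p,
    log_concave p /\ is_pseries (fun k => RtoC (p k / k`!%:R)) (fs n).
  by move=> n; have [p] := fsL n; exists p.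
have pL n : log_concave (p n) := proj1 (pP n).
have coef_ge0 n k : 0 <= p n k / k`!%:R by rewrite divr_ge0 // (proj1 (pL n)).
have coef_bounded r : 0 <= r ->
    exists M, forall n k, cabs (RtoC (p n k / k`!%:R)) * r ^+ k <= M.
  move=> r0; have [M fsM] := cvg_bounded_above (cvg_cabs (fsf (RtoC r))).
  exists M => n k; apply: le_trans (fsM n); rewrite ger0_cabs //.
  exact: (nneg_pseries_coef_le (coef_ge0 n) (proj2 (pP n))).
have [f_series coef_cvg] := cvg_pseries_coef (fun n => proj2 (pP n)) coef_bounded fsf.
have coef_cvgR k : p n k / k`!%:R @[n --> \oo] --> complex.Re (taylor_coef f k : R[i]).
  exact: cvg_Re (coef_cvg k).
exists (fun k => complex.Re (taylor_coef f k : R[i]) * k`!%:R).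
  apply: (log_concave_lim pL) => k.
  rewrite [X in X @ _](_ : _ = fun n => p n k / k`!%:R * k`!%:R).
    exact: cvgM (coef_cvgR k) (cvg_cst _).
  by apply/funext => n; rewrite divfK // fact_neq0.
move: f_series; congr is_pseries; apply/funext => k.
by rewrite mulfK ?fact_neq0 //; apply: cvgC_unique (coef_cvg k) (cvg_RtoC (coef_cvgR k)).
Qed.

End LogConcaveSeries.

Section LaguerreSeries.
Variable R : realType.
Local Notation C := (CC R).
Implicit Types (f : C -> C) (t : nat -> R) (S : R).

Definition weights t S := [/\ nonincreasing_seq t, forall j, 0 <= t j &
  forall n, \sum_(j < n) t j <= S].

Lemma LaguerreP f : Laguerre f <-> exists (c : C) l alpha t S, [/\ 0 <= alpha, weights t S &
  forall z, c * z ^+ l * lag_prod alpha t N z @[N --> \oo] --> f z].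
Proof.
split=> [[c [l [alpha [t [a0 td t0 /cvg_ex[S tS] tf]]]]]|].
  exists c, l, alpha, t, S; split=> // [|z]; last first.
    by under eq_fun do rewrite /lag_prod mulrA; exact: tf.
  split=> //; first exact/nonincreasing_seqP.
  by apply: nneg_sum_le_lim => //; move: tS; rewrite seriesEord.
move=> [c [l [alpha [t [S [a0 [td t0 tS] tf]]]]]].
exists c, l, alpha, t; split=> // [||z]; first exact/nonincreasing_seqP.
  by have [T _ tT] := cvg_nneg_sum t0 tS; rewrite seriesEord; apply/cvg_ex; exists T.
by under eq_fun do rewrite -mulrA; exact: tf.
Qed.

Lemma Laguerre_log_concave_series f : Laguerre f ->
  exists a g, log_concave_series g /\ f = (fun z => a * g z).
Proof.
move=> /LaguerreP[c [l [alpha [t [S [a0 [_ t0 _] tf]]]]]].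
have prodL N := log_concave_lag_prod l N a0 t0.
have [c0|c0] := eqVneq c 0.
  exists 0, (fun z => z ^+ l * lag_prod alpha t 0 z); split; first exact: prodL.
  apply/funext => z; rewrite mul0r; apply: cvgC_unique (tf z) _.
  by apply: cvg_near_cst; apply: nearW => N; rewrite c0 !mul0r.
exists c, (fun z => c^-1 * f z); split; last by apply/funext => z; rewrite /= mulVKf.
apply: (log_concave_series_lim prodL) => z.
rewrite [X in X @ _](_ : _ = fun N => c^-1 * (c * z ^+ l * lag_prod alpha t N z)).
  exact: cvgM (cvg_cst _) (tf z).
by apply/funext => N; rewrite -mulrA mulKf.
Qed.

Lemma Laguerre_pseries f : Laguerre f -> is_pseries (taylor_coef f) f.
Proof.
move=> /Laguerre_log_concave_series[a [g [[p _ pg] ->]]].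
by have ag := pseriesZ a pg; rewrite -(pseries_taylor_coef ag).
Qed.

Lemma Laguerre_coef_le f (r : R) k : Laguerre f -> 0 <= r ->
  cabs (taylor_coef f k) * r ^+ k <= cabs (f (RtoC r)).
Proof.
move=> /Laguerre_log_concave_series[a [g [[p [p0 _] pg] ->]]] r0.
have coef_ge0 i : 0 <= p i / i`!%:R by rewrite divr_ge0.
rewrite -(pseries_taylor_coef (pseriesZ a pg)) !cabsM -mulrA ger0_cabs // ler_wpM2l //.
exact: (nneg_pseries_coef_le coef_ge0 pg).
Qed.

Lemma Laguerre_max_modulus f (r : R) (z : C) : Laguerre f -> cabs z <= r ->
  cabs (f z) <= cabs (f (RtoC r)).
Proof.
move=> /Laguerre_log_concave_series[a [g [[p [p0 _] pg] ->]]] zr.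
have coef_ge0 i : 0 <= p i / i`!%:R by rewrite divr_ge0.
by rewrite !cabsM ler_wpM2l // (nneg_pseries_max_modulus coef_ge0 pg).
Qed.

Lemma Laguerre_log_concave f : Laguerre f -> log_concave (fun k => cabs (derive1n k f 0)).
Proof.
move=> /Laguerre_log_concave_series[a [g [[p pL pg] ->]]].
have := log_concaveZ (cabs_ge0 a) pL; congr log_concave; apply/funext => k.
rewrite (pseries_derive1n0 k (pseriesZ a pg)) mulrCA -(rmorph_nat (@RtoC R)) -rmorphM.
by rewrite cabsM mulrCA divff ?fact_neq0 // mulr1 ger0_cabs // (proj1 pL).
Qed.

Lemma Laguerre_cvg_coef (fs : nat -> C -> C) f : (forall n, Laguerre (fs n)) ->
  (forall z, fs n z @[n --> \oo] --> f z) ->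
  is_pseries (taylor_coef f) f /\
  forall k, taylor_coef (fs n) k @[n --> \oo] --> taylor_coef f k.
Proof.
move=> fsL fsf.
apply: (cvg_pseries_coef (fun n => Laguerre_pseries (fsL n))) => // r r0.
have [M fsM] := cvg_bounded_above (cvg_cabs (fsf (RtoC r))).
by exists M => n k; apply: le_trans (fsM n); exact: Laguerre_coef_le.
Qed.

End LaguerreSeries.

Section LaguerreProducts.
Variable R : realType.
Local Notation C := (CC R).
Implicit Types (t x : nat -> R) (S T s y alpha : R) (w c : C).

Lemma weights_ge0 t S : weights t S -> 0 <= S.
Proof. by case=> _ _ /(_ 0); rewrite big_ord0. Qed.

Lemma weights_le_inv t S J : weights t S -> t J <= S / J.+1%:R.
Proof.
move=> [td _ tS]; rewrite ler_pdivlMr ?ltr0n // mulr_natr.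
apply: le_trans (tS J.+1); rewrite -[X in _ *+ X](card_ord J.+1) -sumr_const.
by apply: ler_sum => j _; apply: td; rewrite -ltnS.
Qed.

Lemma weights_drop t S l : weights t S -> weights (fun j => t (l + j)%N) S.
Proof.
move=> [td t0 tS]; split=> // [i j ij|n]; first by apply: td; rewrite leq_add2l.
by apply: le_trans (tS (l + n)%N); rewrite big_split_ord /= lerDr sumr_ge0.
Qed.

Lemma lag_prod_at0 alpha t N : lag_prod alpha t N (0 : C) = 1.
Proof. by rewrite /lag_prod mulr0 cexp0 mul1r big1 // => j _; rewrite mulr0 addr0. Qed.

Lemma lag_prodD alpha y t N w :
  lag_prod (alpha + y) t N w = lag_prod alpha t N w * cexp (RtoC y * w).
Proof. by rewrite /lag_prod rmorphD mulrDl cexpD mulrAC. Qed.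

Lemma cabs_lag_prod_le alpha t N w : 0 <= alpha -> (forall j, 0 <= t j) ->
  cabs (lag_prod alpha t N w) <= expR ((alpha + \sum_(j < N) t j) * cabs w).
Proof.
move=> a0 t0; elim: N => [|N IH].
  by rewrite /lag_prod !big_ord0 mulr1 addr0 (le_trans (cabs_cexp _)) // cabsM ger0_cabs.
rewrite lag_prodS cabsM big_ord_recr /= addrA (mulrDl _ (t N)) expRD mulrC.
apply: ler_pM => //; apply: le_trans (expR_ge1Dx _).
by rewrite (le_trans (ler_cabsD _ _)) // cabs1 cabsM ger0_cabs.
Qed.

Lemma cabs_lag_prod_ge alpha t N y : 0 <= alpha -> (forall j, 0 <= t j) -> 0 <= y ->
  1 + (alpha + \sum_(j < N) t j) * y <= cabs (lag_prod alpha t N (RtoC y)).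
Proof.
move=> a0 t0 y0; elim: N => [|N IH].
  rewrite /lag_prod !big_ord0 mulr1 addr0 -rmorphM cexp_RtoC ger0_cabs ?expR_ge0 //.
  exact: expR_ge1Dx.
have tNy : 0 <= t N * y by rewrite mulr_ge0.
rewrite lag_prodS cabsM -(rmorphM (@RtoC R)) -(rmorph1 (@RtoC R)) -(rmorphD (@RtoC R)).
rewrite ger0_cabs ?addr_ge0 // big_ord_recr /=.
have := ler_wpM2l (addr_ge0 ler01 tNy) IH; apply: le_trans.
have : 0 <= t N * y * ((alpha + \sum_(j < N) t j) * y).
  by rewrite !mulr_ge0 ?addr_ge0 ?sumr_ge0.
by lra.
Qed.

Lemma cvg_lag_prod_RtoC alpha t S y : 0 <= alpha -> weights t S -> 0 <= y ->
  exists2 q : C, q != 0 & (fun N => lag_prod alpha t N (RtoC y)) @ \oo --> q.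
Proof.
move=> a0 [_ t0 tS] y0; pose g N := expR (alpha * y) * \prod_(j < N) (1 + t j * y).
have ty_ge0 j : 0 <= t j * y by rewrite mulr_ge0.
have g_ge0 N : 0 <= g N.
  by rewrite mulr_ge0 ?expR_ge0 // prodr_ge0 // => j _; rewrite addr_ge0.
have lag_prodE : (fun N => lag_prod alpha t N (RtoC y)) = fun N => RtoC (g N).
  apply/funext => N; rewrite /lag_prod -rmorphM cexp_RtoC [RHS]rmorphM rmorph_prod.
  by congr (_ * _); apply: eq_bigr => j _; rewrite rmorphD rmorph1 rmorphM.
have cabsE N : cabs (lag_prod alpha t N (RtoC y)) = g N.
  by rewrite (congr1 (@^~ N) lag_prodE) ger0_cabs.
have /cvg_ex[q gq] : cvgn g.
  apply: nondecreasing_is_cvgn.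
    apply/nondecreasing_seqP => N; rewrite /g big_ord_recr /= mulrA ler_peMr ?lerDl //.
    exact: g_ge0.
  exists (expR ((alpha + S) * y)) => _ [N _ <-]; rewrite -cabsE.
  apply: le_trans (cabs_lag_prod_le _ _ a0 t0) _; rewrite ger0_cabs // ler_expR.
  by rewrite ler_wpM2r // lerD2l.
exists (RtoC q); last by rewrite lag_prodE; exact: cvg_RtoC.
rewrite fmorph_eq0 gt_eqF // (lt_le_trans ltr01) //; apply: (cvgr_to_ge gq).
apply: nearW => N; rewrite -cabsE; apply: le_trans (cabs_lag_prod_ge N a0 t0 y0).
by rewrite lerDl mulr_ge0 // addr_ge0 ?sumr_ge0.
Qed.

(* The factors beyond the [J]-th are replaced by an exponential of the same total weight. *)
Definition trunc_prod S t J w : C := lag_prod (S - \sum_(j < J) t j) t J w.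

Lemma cvg_trunc_prod alpha t T c w (L : C) : (fun N => \sum_(j < N) t j) @ \oo --> T ->
  c * trunc_prod (alpha + T) t N w @[N --> \oo] --> L <->
  c * lag_prod alpha t N w @[N --> \oo] --> L.
Proof.
move=> tT; have cvg1 : cexp (RtoC (T - \sum_(j < N) t j) * w) @[N --> \oo] --> (1 : C).
  have -> : (1 : C) = cexp (RtoC (T - T) * w) by rewrite subrr rmorph0 mul0r cexp0.
  apply: cvg_cexp; apply: cvgM; last exact: cvg_cst.
  exact: cvg_RtoC (cvgB (cvg_cst T) tT).
apply: (iff_trans _ (cvgM_iff (fun N => c * lag_prod alpha t N w) L (oner_neq0 _) cvg1)).
have -> : (fun N => c * lag_prod alpha t N w * cexp (RtoC (T - \sum_(j < N) t j) * w)) =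
    fun N => c * trunc_prod (alpha + T) t N w.
  by apply/funext => N; rewrite /trunc_prod -addrA lag_prodD mulrA.
by rewrite (mulr1 L).
Qed.

Lemma cabs_trunc_prodS_le t S J w : weights t S ->
  cabs (trunc_prod S t J.+1 w - trunc_prod S t J w) <=
  expR (S * cabs w) * cabs w ^+ 2 * t J ^+ 2.
Proof.
move=> [_ t0 tS]; rewrite /trunc_prod; set s := S - \sum_(j < J.+1) t j.
have s0 : 0 <= s by rewrite subr_ge0; exact: tS.
have sE : S - \sum_(j < J) t j = s + t J by rewrite /s big_ord_recr /=; ring.
have SE : S * cabs w = (s + \sum_(j < J) t j) * cabs w + t J * cabs w.
  by rewrite /s big_ord_recr /=; ring.
have -> : lag_prod s t J.+1 w - lag_prod (S - \sum_(j < J) t j) t J w =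
    - (lag_prod s t J w * (cexp (RtoC (t J) * w) - (1 + RtoC (t J) * w))).
  by rewrite sE lag_prodD lag_prodS; ring.
have -> : expR (S * cabs w) * cabs w ^+ 2 * t J ^+ 2 =
    expR ((s + \sum_(j < J) t j) * cabs w) * ((t J * cabs w) ^+ 2 * expR (t J * cabs w)).
  by rewrite SE expRD; ring.
rewrite cabsN cabsM; apply: ler_pM => //; first exact: cabs_lag_prod_le.
by have := cabs_cexp_taylor1 (RtoC (t J) * w); rewrite cabsM ger0_cabs.
Qed.

(* The differences telescope, and [t j <= S / J.+1] for [j >= J], so that the sum of the
   [t j ^+ 2] over [j >= J] is at most [S ^+ 2 / J.+1]. *)
Lemma cabs_trunc_prodB_le t S J N w : weights t S -> (J <= N)%N ->
  cabs (trunc_prod S t N w - trunc_prod S t J w) <=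
  expR (S * cabs w) * cabs w ^+ 2 * (S ^+ 2 / J.+1%:R).
Proof.
move=> wt /subnKC <-; move: (N - J)%N => m; have [td t0 tS] := wt; have S0 := weights_ge0 wt.
set E := expR _ * _; have E0 : 0 <= E by rewrite mulr_ge0 ?expR_ge0 ?exprn_ge0.
have tJ_sum_le : S / J.+1%:R * (\sum_(j < J + m) t j - \sum_(j < J) t j) <= S ^+ 2 / J.+1%:R.
  rewrite expr2 [leRHS]mulrAC ler_wpM2l ?divr_ge0 //.
  by rewrite lerBlDr (le_trans (tS _)) // lerDl sumr_ge0.
apply: le_trans (ler_wpM2l E0 tJ_sum_le).
elim: m {tJ_sum_le} => [|m IH]; first by rewrite addn0 !subrr !mulr0 cabs0.
rewrite addnS -(subrK (trunc_prod S t (J + m) w) (trunc_prod _ _ _.+1 _)) -addrA.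
apply: le_trans (ler_cabsD _ _) _.
apply: le_trans (lerD (cabs_trunc_prodS_le (J + m) w wt) IH) _.
rewrite -mulrDr ler_wpM2l // big_ord_recr /=.
have : t (J + m)%N ^+ 2 <= S / J.+1%:R * t (J + m)%N.
  rewrite expr2 ler_wpM2r //; apply: le_trans (weights_le_inv J wt).
  by apply: td; exact: leq_addr.
by move: (S / _) => a; lra.
Qed.

Lemma weights_lim (F : set_system nat) {FF : ProperFilter F}
    (ts : nat -> nat -> R) t (Ss : nat -> R) S :
  (forall n, weights (ts n) (Ss n)) -> (forall j, ts n j @[n --> F] --> t j) ->
  Ss n @[n --> F] --> S -> weights t S.
Proof.
move=> wts tst SsS; split=> [|j|J].
- apply/nonincreasing_seqP => j; apply: (ler_cvg_to (tst j.+1) (tst j)).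
  by apply: nearW => n; have [td _ _] := wts n; exact: td.
- by apply: (cvgr_to_ge (tst j)); apply: nearW => n; have [] := wts n.
have sum_cvg : \sum_(j < J) ts n j @[n --> F] --> \sum_(j < J) t j.
  by apply: cvg_big => [|j _]; [exact: add_continuous|exact: tst].
by apply: (ler_cvg_to sum_cvg SsS); apply: nearW => n; have [] := wts n.
Qed.

Lemma trunc_prod_cvg (F : set_system nat) {FF : Filter F}
    (ts : nat -> nat -> R) t (Ss : nat -> R) S J w :
  (forall j, ts n j @[n --> F] --> t j) -> Ss n @[n --> F] --> S ->
  trunc_prod (Ss n) (ts n) J w @[n --> F] --> trunc_prod S t J w.
Proof.
move=> tst SsS.
have sum_cvg : \sum_(j < J) ts n j @[n --> F] --> \sum_(j < J) t j.
  by apply: cvg_big => [|j _]; [exact: add_continuous|exact: tst].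
apply: cvgM.
  apply: cvg_cexp; apply: cvgM; last exact: cvg_cst.
  exact: cvg_RtoC (cvgB SsS sum_cvg).
apply: cvg_big => [|j _]; first exact: mul_continuous.
apply: cvgD; first exact: cvg_cst.
by apply: cvgM; [exact: cvg_RtoC (tst j)|exact: cvg_cst].
Qed.

End LaguerreProducts.

(* Translating by [s > 0] turns the factor [1 + x z], up to a constant, into [1 + t w] with
   [t = x / (1 + x s)], and a zero at the origin into [1 + w / s]. *)
Definition shift_weights (R : realType) (s : R) l (x : nat -> R) : nat -> R :=
  fun j => if (j < l)%N then s^-1 else x (j - l)%N / (1 + x (j - l)%N * s).

Section Recentring.
Variables (R : realType) (s : R).
Local Notation C := (CC R).
Hypothesis s_gt0 : 0 < s.
Implicit Types (f : C -> C) (t x : nat -> R) (S T alpha : R) (w c : C).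

Let s_ge0 : 0 <= s := ltW s_gt0.
Let s_neq0 : s != 0 := lt0r_neq0 s_gt0.
Let sC_neq0 : RtoC s != 0.
Proof. by rewrite fmorph_eq0. Qed.

Lemma shift_weights_head l x j : (j < l)%N -> shift_weights s l x j = s^-1.
Proof. by rewrite /shift_weights => ->. Qed.

Lemma shift_weights_tail l x j : shift_weights s l x (l + j) = x j / (1 + x j * s).
Proof. by rewrite /shift_weights ltnNge leq_addr /= addKn. Qed.

Let shift_denom_gt0 x j : (forall j, 0 <= x j) -> 0 < 1 + x j * s.
Proof. by move=> x0; rewrite ltr_pwDl // mulr_ge0. Qed.

Lemma shift_weights_le_inv l x j : (forall j, 0 <= x j) -> shift_weights s l x j <= s^-1.
Proof.
move=> x0; case: (ltnP j l) => [jl|/subnKC <-]; first by rewrite shift_weights_head.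
rewrite shift_weights_tail ler_pdivrMr ?shift_denom_gt0 // mulrDr mulr1.
by rewrite mulrCA mulVf // mulr1 lerDr invr_ge0.
Qed.

Lemma weights_shift l x S : weights x S -> weights (shift_weights s l x) (l%:R / s + S).
Proof.
move=> [xd x0 xS]; have tail_ge0 j : 0 <= x j / (1 + x j * s).
  by rewrite divr_ge0 // ltW ?shift_denom_gt0.
have shift_ge0 j : 0 <= shift_weights s l x j.
  case: (ltnP j l) => [jl|/subnKC <-]; last by rewrite shift_weights_tail.
  by rewrite shift_weights_head // invr_ge0.
split=> // [|n].
  apply/nonincreasing_seqP => j; case: (ltnP j l) => [jl|/subnKC <-].
    by rewrite (shift_weights_head _ jl) shift_weights_le_inv.
  rewrite -addnS !shift_weights_tail.
  rewrite ler_pdivrMr ?shift_denom_gt0 // mulrAC ler_pdivlMr ?shift_denom_gt0 //.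
  by have := xd _ _ (leqnSn (j - l)%N); lra.
apply: (@le_trans _ _ (\sum_(j < l + n) shift_weights s l x j)).
  by rewrite addnC big_split_ord /= lerDl sumr_ge0.
rewrite big_split_ord /= lerD //.
  rewrite (eq_bigr (fun=> s^-1)); last by move=> j _; rewrite shift_weights_head.
  by rewrite sumr_const card_ord mulrC mulr_natr.
apply: le_trans (xS n); apply: ler_sum => j _; rewrite shift_weights_tail.
by rewrite ler_pdivrMr ?shift_denom_gt0 // ler_peMr // lerDl mulr_ge0.
Qed.

Lemma weights_unshift t S : weights t S -> t 0 * s < 1 ->
  exists x, weights x (S / (1 - t 0 * s)) /\ forall j, t j = x j / (1 + x j * s).
Proof.
move=> [td t0 tS] t0s; have ts_le j : t j * s <= t 0 * s by rewrite ler_wpM2r ?td.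
have d0 j : 0 < 1 - t j * s by rewrite subr_gt0 (le_lt_trans (ts_le j)).
exists (fun j => t j / (1 - t j * s)); split=> [|j]; last first.
  have dn0 := lt0r_neq0 (d0 j); have -> : 1 + t j / (1 - t j * s) * s = (1 - t j * s)^-1.
    by field.
  by rewrite invrK divfK.
split=> [||n].
- apply/nonincreasing_seqP => j; rewrite ler_pdivrMr // mulrAC ler_pdivlMr //.
  by have := td _ _ (leqnSn j); lra.
- by move=> j; rewrite divr_ge0 // ltW.
apply: (@le_trans _ _ (\sum_(j < n) t j / (1 - t 0 * s))).
  by apply: ler_sum => j _; rewrite ler_wpM2l // lef_pV2 ?posrE // lerD2l lerN2.
by rewrite -mulr_suml ler_wpM2r // invr_ge0 ltW.
Qed.

Lemma shift_weights_surj t S : weights t S -> t 0 <= s^-1 ->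
  exists l x S', weights x S' /\ t = shift_weights s l x.
Proof.
move=> wt ts; have [td _ _] := wt.
have ex_lt : exists l, t l < s^-1.
  have Ss0 : 0 <= S * s by rewrite mulr_ge0 // (weights_ge0 wt).
  exists (Num.Def.archi_bound (S * s)); apply: le_lt_trans (weights_le_inv _ wt) _.
  rewrite ltr_pdivrMr // ltr_pdivlMl // mulrC; apply: lt_trans (archi_boundP Ss0) _.
  by rewrite ltr_nat.
case: (ex_minnP ex_lt) => l tl l_min.
have wtl := weights_drop l wt.
have [|x [wx tx]] := weights_unshift wtl; first by rewrite addn0 -ltr_pdivlMr // mul1r.
exists l, x, (S / (1 - t (l + 0)%N * s)); split=> //; apply/funext => j.
case: (ltnP j l) => [jl|/subnKC <-]; last by rewrite shift_weights_tail tx.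
rewrite shift_weights_head //; apply/eqP; rewrite eq_le (le_trans (td 0 j _) ts) //=.
by rewrite leNgt; apply/negP => /l_min; rewrite leqNgt jl.
Qed.

Lemma lag_prod_shift alpha l x N w : (forall j, 0 <= x j) ->
  (RtoC s + w) ^+ l * lag_prod alpha x N (RtoC s + w) =
  RtoC s ^+ l * lag_prod alpha x N (RtoC s) * lag_prod alpha (shift_weights s l x) (l + N) w.
Proof.
move=> x0; rewrite /lag_prod mulrDr cexpD big_split_ord /=.
have -> : (RtoC s + w) ^+ l =
    RtoC s ^+ l * \prod_(j < l) (1 + RtoC (shift_weights s l x j) * w).
  rewrite (eq_bigr (fun=> 1 + RtoC s^-1 * w)); last by move=> j _; rewrite shift_weights_head.
  by rewrite prodr_const card_ord -exprMn mulrDr mulr1 fmorphV mulVKf.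
have -> : \prod_(j < N) (1 + RtoC (x j) * (RtoC s + w)) =
    \prod_(j < N) (1 + RtoC (x j) * RtoC s) *
    \prod_(j < N) (1 + RtoC (shift_weights s l x (l + j)) * w).
  rewrite -big_split; apply: eq_bigr => j _; rewrite shift_weights_tail.
  have d0 : 1 + RtoC (x j) * RtoC s != 0.
    by rewrite -rmorphM -(rmorph1 (@RtoC R)) -rmorphD fmorph_eq0 gt_eqF ?shift_denom_gt0.
  rewrite rmorphM fmorphV rmorphD rmorph1 rmorphM /=.
  by field.
move: (cexp (RtoC alpha * RtoC s)) (cexp (RtoC alpha * w)) => exps expw.
ring.
Qed.

(* Here [q] is the limit of [lag_prod alpha x N s]. *)
Lemma cvg_lag_prod_shift alpha l x S : 0 <= alpha -> weights x S ->
  exists2 q : C, q != 0 & forall c w L,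
    c * (RtoC s + w) ^+ l * lag_prod alpha x N (RtoC s + w) @[N --> \oo] --> L * q <->
    c * RtoC s ^+ l * lag_prod alpha (shift_weights s l x) N w @[N --> \oo] --> L.
Proof.
move=> a0 wx; have [_ x0 _] := wx.
have [q q0 xq] := cvg_lag_prod_RtoC a0 wx s_ge0; exists q => [|c w L]; first exact: q0.
pose g N := c * RtoC s ^+ l * lag_prod alpha (shift_weights s l x) N w.
rewrite -(cvg_shiftn l g); apply: (iff_trans _ (cvgM_iff (fun N => g (N + l)%N) L q0 xq)).
have -> : (fun N => g (N + l)%N * lag_prod alpha x N (RtoC s)) =
    fun N => c * (RtoC s + w) ^+ l * lag_prod alpha x N (RtoC s + w).
  by apply/funext => N; rewrite /g -[RHS]mulrA lag_prod_shift // addnC; ring.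
by [].
Qed.

Definition recentred f t S := [/\ weights t S, t 0 <= s^-1 & forall w,
  f (RtoC s) * trunc_prod S t J w @[J --> \oo] --> f (RtoC s + w)].

Lemma Laguerre_recentred f : Laguerre f -> exists t S, recentred f t S.
Proof.
move=> /LaguerreP[c [l [alpha [x [S [a0 wx xf]]]]]]; have [_ x0 _] := wx.
have [q q0 shiftP] := cvg_lag_prod_shift l a0 wx.
pose t := shift_weights s l x; have [td t0 tS] : weights t _ := weights_shift l wx.
have fsE : f (RtoC s) = c * RtoC s ^+ l * q.
  apply: cvgC_unique (xf _) _; rewrite -[RtoC s]addr0.
  apply/(shiftP c 0); apply: cvg_near_cst; apply: nearW => N.
  by rewrite lag_prod_at0 mulr1 addr0.
have [T _ tT] := cvg_nneg_sum t0 tS.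
exists t, (alpha + T); split=> [||w].
- split=> // n; apply: (@le_trans _ _ T); last by rewrite lerDr.
  exact: nneg_sum_le_lim.
- exact: shift_weights_le_inv.
apply/(cvg_trunc_prod _ _ _ _ tT).
have tf : c * RtoC s ^+ l * lag_prod alpha t N w @[N --> \oo] --> f (RtoC s + w) / q.
  by apply/(shiftP c w); rewrite divfK //; exact: xf.
rewrite -(divfK q0 (f (RtoC s + w))) [X in X @ _](_ : _ = fun N =>
    c * RtoC s ^+ l * lag_prod alpha t N w * q); first exact: cvgM tf (cvg_cst q).
by apply/funext => N; rewrite fsE mulrAC.
Qed.

Lemma recentred_Laguerre f t S : recentred f t S -> Laguerre f.
Proof.
move=> [wt ts tf]; have [_ t0 tS] := wt; have [T TS tT] := cvg_nneg_sum t0 tS.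
have [l [x [S' [wx tE]]]] := shift_weights_surj wt ts.
have a0 : 0 <= S - T by rewrite subr_ge0.
have [q q0 shiftP] := cvg_lag_prod_shift l a0 wx.
apply/LaguerreP; exists (f (RtoC s) / RtoC s ^+ l / q), l, (S - T), x, S'.
split; [exact: a0|exact: wx|move=> z].
have -> : z = RtoC s + (z - RtoC s) by rewrite addrC subrK.
move: (z - RtoC s) => w {z}.
have lag_f : f (RtoC s) * lag_prod (S - T) t N w @[N --> \oo] --> f (RtoC s + w).
  by apply: (iffLR (cvg_trunc_prod _ _ _ _ tT)); rewrite subrK; exact: tf.
have shift_f : f (RtoC s) / RtoC s ^+ l * (RtoC s + w) ^+ l *
    lag_prod (S - T) x N (RtoC s + w) @[N --> \oo] --> f (RtoC s + w) * q.
  by apply/(shiftP _ w); rewrite -tE divfK ?expf_neq0.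
rewrite -(mulfK q0 (f (RtoC s + w))) [X in X @ _](_ : _ = fun N =>
    f (RtoC s) / RtoC s ^+ l * (RtoC s + w) ^+ l * lag_prod (S - T) x N (RtoC s + w) / q).
  exact: cvgM shift_f (cvg_cst q^-1).
by apply/funext => N; move: (lag_prod _ _ _ _) => P; ring.
Qed.

Lemma recentred_trunc_prod_le f t S J w : recentred f t S ->
  cabs (f (RtoC s + w) - f (RtoC s) * trunc_prod S t J w) <=
  cabs (f (RtoC s)) * (expR (S * cabs w) * cabs w ^+ 2 * (S ^+ 2 / J.+1%:R)).
Proof.
move=> [wt _ tf]; apply: cabs_lim_le (cvgB (tf w) (cvg_cst _)) _; near=> N.
rewrite -mulrBr cabsM ler_wpM2l //; apply: cabs_trunc_prodB_le => //.
by near: N; exact: nbhs_infty_ge.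
Unshelve. all: by end_near. Qed.

Lemma recentred_weight_le f t S : recentred f t S ->
  cabs (f (RtoC s)) * S <= cabs (f (RtoC s + 1)).
Proof.
move=> [[_ t0 tS] _ tf]; apply: (cvgr_to_ge (cvg_cabs (tf 1))); apply: nearW => N.
rewrite cabsM ler_wpM2l // /trunc_prod -(rmorph1 (@RtoC R)).
apply: le_trans (cabs_lag_prod_ge N _ t0 ler01); last by rewrite subr_ge0.
by rewrite subrK mulr1 lerDr.
Qed.

Lemma recentred_lim (F : set_system nat) {FF : ProperFilter F}
    (fs : nat -> C -> C) f (ts : nat -> nat -> R) t (Ss : nat -> R) S :
  (forall n, recentred (fs n) (ts n) (Ss n)) -> (forall z, fs n z @[n --> F] --> f z) ->
  (forall j, ts n j @[n --> F] --> t j) -> Ss n @[n --> F] --> S -> recentred f t S.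
Proof.
move=> fsR fsf tst SsS; split=> [||w].
- by apply: (weights_lim _ tst SsS) => n; have [] := fsR n.
- by apply: (cvgr_to_le (tst 0%N)); apply: nearW => n; have [] := fsR n.
pose E (J : nat) (v : R) := expR (v * cabs w) * cabs w ^+ 2 * (v ^+ 2 / J.+1%:R).
apply: (@squeeze_cabs _ _ _ _ (fun J => cabs (f (RtoC s)) * E J S)); last first.
  pose K := cabs (f (RtoC s)) * (expR (S * cabs w) * cabs w ^+ 2) * S ^+ 2.
  rewrite -(mulr0 K) [X in X @ _](_ : _ = fun J => K * harmonic J).
    exact: cvgM (cvg_cst _) cvg_harmonic.
  by apply/funext => J; rewrite /E /K !mulrA.
apply: nearW => J; rewrite cabs_distC.
have dist_cvg : cabs (fs n (RtoC s + w) - fs n (RtoC s) * trunc_prod (Ss n) (ts n) J w)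
    @[n --> F] --> cabs (f (RtoC s + w) - f (RtoC s) * trunc_prod S t J w).
  apply: cvg_cabs; apply: cvgB; first exact: fsf.
  by apply: cvgM; [exact: fsf|exact: trunc_prod_cvg].
have bound_cvg : cabs (fs n (RtoC s)) * E J (Ss n) @[n --> F] --> cabs (f (RtoC s)) * E J S.
  apply: cvgM; first exact: cvg_cabs (fsf (RtoC s)).
  apply: cvgM; last by apply: cvgM; [exact: (cvgM SsS SsS)|exact: cvg_cst].
  apply: cvgM; last exact: cvg_cst.
  apply: continuous_cvg; first exact: continuous_expR.
  by apply: cvgM; [exact: SsS|exact: cvg_cst].
apply: (ler_cvg_to dist_cvg bound_cvg); apply: nearW => n.
exact: recentred_trunc_prod_le.
Qed.

End Recentring.

Lemma Laguerre_closed (R : realType) (fs : nat -> CC R -> CC R) (f : CC R -> CC R) :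
  (forall n, Laguerre (fs n)) -> (forall z, fs n z @[n --> \oo] --> f z) ->
  (exists z, f z != 0) -> Laguerre f.
Proof.
move=> fsL fsf [z0 fz0]; pose s := cabs z0 + 1.
have s_gt0 : 0 < s by rewrite ltr_wpDl.
have f_s_gt0 : 0 < cabs (f (RtoC s)).
  apply: (@lt_le_trans _ _ (cabs (f z0))); first by rewrite cabs_gt0.
  apply: (ler_cvg_to (cvg_cabs (fsf z0)) (cvg_cabs (fsf (RtoC s)))).
  by apply: nearW => n; apply: Laguerre_max_modulus => //; rewrite lerDl.
have /choice[t /choice[S fsR]] : forall n, exists t S, recentred s (fs n) t S.
  by move=> n; exact: Laguerre_recentred.
have S_ge0 n : 0 <= S n by have [/weights_ge0] := fsR n.
have [M fs1M] := cvg_bounded_above (cvg_cabs (fsf (RtoC s + 1))).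
have S_bounded : \forall n \near \oo, `|S n| <= M / (cabs (f (RtoC s)) / 2).
  have half_lt : cabs (f (RtoC s)) / 2 < cabs (f (RtoC s)) by lra.
  move: half_lt => /(cvgr_ge _ (cvg_cabs (fsf (RtoC s)))); apply: filterS => n fsn.
  rewrite ger0_norm // ler_pdivlMr ?divr_gt0 // mulrC.
  exact: le_trans (ler_wpM2r (S_ge0 n) fsn) (le_trans (recentred_weight_le (fsR n)) (fs1M n)).
have [U [ultraU ooU]] := @ultraFilterLemma nat \oo _.
have [Slim S_cvg] : exists l : R, S n @[n --> U] --> l.
  by apply: ultra_bounded_cvg; exact: ooU S_bounded.
have /choice[tlim t_cvg] : forall j, exists l : R, t n j @[n --> U] --> l.
  move=> j; apply: (@ultra_bounded_cvg _ _ _ _ _ s^-1); apply: nearW => n.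
  have [[td t0 _] ts _] := fsR n.
  by rewrite ger0_norm // (le_trans (td 0 j _) ts).
apply: (recentred_Laguerre s_gt0 (recentred_lim fsR _ t_cvg S_cvg)) => z.
exact: cvg_trans (cvg_app _ ooU) (fsf z).
Qed.

Section UniformBounds.
Variable R : realType.
Implicit Types (e : nat -> R) (es : nat -> nat -> R) (b M : R).

Lemma bounded_above_initial (T : Type) (v : nat -> T -> R) N :
  (forall n, exists M, forall x, v n x <= M) ->
  exists M, forall n x, (n < N)%N -> v n x <= M.
Proof.
move=> vM; elim: N => [|N [M IH]]; first by exists 0.
have [M' vM'] := vM N; exists (Num.max M M') => n x; rewrite ltnS leq_eqVlt le_max.
by case/orP => [/eqP->|nN]; rewrite ?vM' ?orbT // IH.
Qed.

Lemma bounded_above_near (T : Type) (v : nat -> T -> R) M :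
  (forall n, exists M, forall x, v n x <= M) ->
  (\forall n \near \oo, forall x, v n x <= M) -> exists M, forall n x, v n x <= M.
Proof.
move=> vM [N _ vN]; have [M' vM'] := bounded_above_initial N vM.
exists (Num.max M M') => n x; rewrite le_max.
by case: (ltnP n N) => [nN|/vN vnM]; apply/orP; [right; exact: vM'|left; exact: vnM].
Qed.

Lemma log_concave_geometric_tail e k b : log_concave e -> 0 < e k -> e k.+1 <= b * e k ->
  0 <= b -> forall j, e (k + j)%N <= b ^+ j * e k.
Proof.
move=> [e0 eL] ek eb b0; elim=> [|j IH]; first by rewrite addn0 mul1r.
rewrite addnS exprS -mulrA; apply: le_trans (ler_wpM2l b0 IH).
rewrite -(ler_pM2l ek); apply: le_trans (eL _ _ (leq_addr j k)) _.
by apply: le_trans (ler_wpM2r (e0 _) eb) _; rewrite mulrA [e k * b]mulrC.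
Qed.

Lemma cvg_exp_ratio b (b' M : R) : 0 <= b' -> b' < b ->
  M * (b' / b) ^+ n @[n --> \oo] --> (0 : R).
Proof.
move=> b'0 b'b; have b0 : 0 < b by exact: le_lt_trans b'b.
by apply: cvg_geometric; rewrite ger0_norm ?divr_ge0 ?(ltW b0) // ltr_pdivrMr // mul1r.
Qed.

Lemma geometric_uniform_cvg0 es b (b' M : R) : 0 <= b' -> b' < b ->
  (forall n k, es n k <= M * b' ^+ k) -> (forall k, es n k @[n --> \oo] --> (0 : R)) ->
  forall d, 0 < d -> \forall n \near \oo, forall k, es n k <= d * b ^+ k.
Proof.
move=> b'0 b'b esM es0 d d0; have b0 : 0 < b by exact: le_lt_trans b'b.
have [K _ tail_small] : \forall k \near \oo, M * (b' / b) ^+ k <= d.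
  exact: (cvgr_le _ (cvg_exp_ratio _ b'0 b'b)).
have : \forall n \near \oo, forall k : 'I_K, es n k <= d * b ^+ k.
  apply: filter_forall => k; apply: (cvgr_le _ (es0 k)).
  by rewrite mulr_gt0 // exprn_gt0.
apply: filterS => n head_small k.
case: (ltnP k K) => kK; first exact: (head_small (Ordinal kK)).
apply: le_trans (esM n k) _.
by have := tail_small k kK; rewrite /= exprMn exprVn mulrA ler_pdivrMr ?exprn_gt0.
Qed.

Lemma exists_ratio_lt e b (b' M : R) l : 0 <= b' -> b' < b -> 0 < e l ->
  (forall k, e k <= M * b' ^+ k) -> exists k, 0 < e k /\ e k.+1 < b * e k.
Proof.
move=> b'0 b'b el eM; apply: contrapT => no_ratio.
have b0 : 0 < b by exact: le_lt_trans b'b.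
have grow j : b ^+ j * e l <= e (l + j)%N.
  elim: j => [|j IH]; first by rewrite mul1r addn0.
  have ej : 0 < e (l + j)%N by apply: lt_le_trans IH; rewrite mulr_gt0 ?exprn_gt0.
  rewrite addnS exprS -mulrA; apply: le_trans (ler_wpM2l (ltW b0) IH) _.
  by rewrite leNgt; apply/negP => ?; apply: no_ratio; exists (l + j)%N.
suff : e l <= 0 by rewrite leNgt el.
apply: (cvgr_to_ge (cvg_exp_ratio (M * b' ^+ l) b'0 b'b)); apply: nearW => j.
rewrite exprMn exprVn mulrA ler_pdivlMr ?exprn_gt0 // mulrC.
by apply: le_trans (grow j) (le_trans (eM _) _); rewrite exprD mulrA.
Qed.

(* A ratio [e k0.+1 / e k0 < b] of the limit persists for large [n], and log-concavity
   propagates it to all [k >= k0]. *)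
Lemma log_concave_near_bounded es e l b (b' M : R) : 0 <= b' -> b' < b ->
  (forall n, log_concave (es n)) -> (forall k, es n k @[n --> \oo] --> e k) ->
  0 < e l -> (forall k, e k <= M * b' ^+ k) ->
  exists M', \forall n \near \oo, forall k, es n k / b ^+ k <= M'.
Proof.
move=> b'0 b'b esL ese el eM; have b0 : 0 < b by exact: le_lt_trans b'b.
have [k0 [ek0 ek1]] := exists_ratio_lt b'0 b'b el eM.
have [|M' esM'] := @bounded_above_initial _ (fun k n => es n k / b ^+ k) k0.+1.
  by move=> k; apply: cvg_bounded_above (cvgM (ese k) (cvg_cst _)).
exists M'; near=> n.
have en0 : 0 < es n k0 by near: n; apply: (cvgr_gt _ (ese k0)).
have en1 : es n k0.+1 <= b * es n k0.
  rewrite -subr_ge0; near: n.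
  have ratio_cvg : b * es n k0 - es n k0.+1 @[n --> \oo] --> b * e k0 - e k0.+1.
    by apply: cvgB; [apply: cvgM; [exact: cvg_cst|exact: ese]|exact: ese].
  by apply: (cvgr_ge _ ratio_cvg); rewrite subr_gt0.
move=> k; case: (leqP k k0) => [|/ltnW/subnKC <-]; first exact: esM'.
move: (k - k0)%N => j; apply: le_trans (esM' k0 n (ltnSn k0)).
have tail := log_concave_geometric_tail (esL n) en0 en1 (ltW b0) j.
rewrite ler_pdivrMr ?exprn_gt0 // exprD mulrA divfK ?expf_neq0 ?gt_eqF //.
by rewrite mulrC.
Unshelve. all: by end_near. Qed.

Lemma log_concave_uniform_bound es e l (a : R) : 0 <= a ->
  (forall n, log_concave (es n)) -> (forall k, es n k @[n --> \oo] --> e k) -> 0 < e l ->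
  (forall b, a < b -> exists M, forall k, e k <= M * b ^+ k) ->
  (forall n b, a < b -> exists M, forall k, es n k <= M * b ^+ k) ->
  forall b, a < b -> exists M, forall n k, es n k <= M * b ^+ k.
Proof.
move=> a0 esL ese el eM esM b ab; have b0 : 0 < b by exact: le_lt_trans ab.
have [a_mid mid_b] := midf_lt ab.
have [M eM'] := eM _ a_mid.
have [M' near_bound] := log_concave_near_bounded (le_trans a0 (ltW a_mid)) mid_b esL ese el eM'.
have [|M'' esM''] := bounded_above_near _ near_bound.
  move=> n; have [Mn esMn] := esM n b ab; exists Mn => k.
  by rewrite ler_pdivrMr ?exprn_gt0.
by exists M'' => n k; rewrite -ler_pdivrMr ?exprn_gt0.
Qed.

End UniformBounds.

Section NormA.
Variable R : realType.
Local Notation C := (CC R).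
Implicit Types (f g : C -> C) (fs gs : nat -> C -> C) (a b M : R).

Lemma normA_le b g M : 0 < b -> (forall k, cabs (derive1n k g 0) <= M * b ^+ k) ->
  (normA b g <= M%:E)%E.
Proof.
move=> b0 gM; apply: ge_ereal_sup => _ [k _ <-]; rewrite lee_fin mulrC.
by rewrite ler_pdivrMr ?exprn_gt0 //; exact: gM.
Qed.

Lemma normA_ge0 b g : (0 <= normA b g)%E.
Proof.
apply: (@le_trans _ _ (b ^- 0 * cabs (derive1n 0 g 0))%:E).
  by rewrite lee_fin expr0 invr1 mul1r.
by apply: ereal_sup_ubound; exists 0%N.
Qed.

Lemma normA_fin b g M : (normA b g <= M%:E)%E -> normA b g \is a fin_num.
Proof. by move=> gM; rewrite ge0_fin_numE ?normA_ge0 // (le_lt_trans gM) // ltry. Qed.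

Lemma derive1n_le_normA b g k M : 0 < b -> (normA b g <= M%:E)%E ->
  cabs (derive1n k g 0) <= M * b ^+ k.
Proof.
move=> b0 gM; rewrite -ler_pdivrMr ?exprn_gt0 // -lee_fin; apply: le_trans gM.
by apply: ereal_sup_ubound; exists k => //; rewrite mulrC.
Qed.

Lemma A_space_bound a f b : 0 <= a -> A_space a f -> a < b ->
  exists M, forall k, cabs (derive1n k f 0) <= M * b ^+ k.
Proof.
move=> a0 [_ /(_ b) fA] ab; have b0 : 0 < b by exact: le_lt_trans ab.
exists (fine (normA b f)) => k; apply: derive1n_le_normA => //.
by rewrite fineK // ge0_fin_numE ?normA_ge0 ?fA.
Qed.

Lemma cvg_normA b gs : 0 < b ->
  (forall e, 0 < e -> \forall n \near \oo,
     forall k, cabs (derive1n k (gs n) 0) <= e * b ^+ k) ->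
  normA b (gs n) @[n --> \oo] --> 0%E.
Proof.
move=> b0 gs_small.
have normA_small e : 0 < e -> \forall n \near \oo, (normA b (gs n) <= e%:E)%E.
  by move=> /gs_small; apply: filterS => n; exact: normA_le.
apply/fine_cvgP; split; first by move: (normA_small 1 ltr01); apply: filterS => n /normA_fin.
apply/cvgr0Pnorm_le => e /normA_small; apply: filterS => n gne /=.
by rewrite ger0_norm ?fine_ge0 ?normA_ge0 // -lee_fin fineK // (normA_fin gne).
Qed.

Lemma bounded_cvg_in_A (cs : nat -> nat -> C) (c : nat -> C) fs f a : 0 <= a ->
  (forall n, is_pseries (cs n) (fs n)) -> is_pseries c f ->
  (forall k, cs n k @[n --> \oo] --> c k) ->
  bounded_in_A a (range fs) -> cvg_in_A a fs f.
Proof.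
move=> a0 csfs cf csc fsB b ab.
have [a_mid mid_b] := midf_lt ab.
set b' := (a + b) / 2 in a_mid mid_b; have b'0 : 0 < b' by exact: le_lt_trans a_mid.
have [M fsM] := fsB b' a_mid.
have csM n k : k`!%:R * cabs (cs n k) <= M * b' ^+ k.
  rewrite -cabs_nat -cabsM -(pseries_derive1n0 k (csfs n)).
  by apply: derive1n_le_normA => //; apply: fsM; exists n.
have cM k : k`!%:R * cabs (c k) <= M * b' ^+ k.
  have cs_cvg : k`!%:R * cabs (cs n k) @[n --> \oo] --> k`!%:R * cabs (c k).
    by apply: cvgM; [exact: cvg_cst|exact: cvg_cabs].
  by apply: (cvgr_to_le cs_cvg); apply: nearW => n; exact: csM.
pose D n k := cabs (derive1n k (fun z => fs n z - f z) 0).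
have DE n k : D n k = k`!%:R * cabs (cs n k - c k).
  by rewrite /D (pseries_derive1n0 k (pseriesB (csfs n) cf)) cabsM cabs_nat.
apply: cvg_normA (lt_trans b'0 mid_b) _.
apply: (@geometric_uniform_cvg0 _ D b b' (2 * M)) => // [|n k|k]; first exact: ltW.
- rewrite DE; apply: le_trans (ler_wpM2l _ (ler_cabsB _ _)) _ => //.
  by rewrite mulrDr; have := csM n k; have := cM k; lra.
- rewrite -(mulr0 k`!%:R); under eq_fun do rewrite DE.
  by apply: cvgM; [exact: cvg_cst|apply/cvg_cabsP; exact: csc].
Qed.

Lemma cvg_compact_pointwise fs f : cvg_compact fs f ->
  forall z, fs n z @[n --> \oo] --> f z.
Proof.
move=> fsf z; apply/cvg_cabsP/cvgr0Pnorm_lt => e e0.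
have := fsf _ (@compact_set1 _ z) e e0; apply: filterS => n /(_ z erefl).
by rewrite ger0_norm.
Qed.

Lemma Laguerre_bounded_in_A fs f a : 0 <= a -> (forall n, Laguerre_a a (fs n)) ->
  (forall z, fs n z @[n --> \oo] --> f z) -> A_space a f -> (exists z, f z != 0) ->
  bounded_in_A a (range fs).
Proof.
move=> a0 fsA fsf fA [z fz] b ab; have b0 : 0 < b by exact: le_lt_trans ab.
have fsL n : Laguerre (fs n) by have [] := fsA n.
have [f_series coef_cvg] := Laguerre_cvg_coef fsL fsf.
have derive_cvg k : cabs (derive1n k (fs n) 0) @[n --> \oo] --> cabs (derive1n k f 0).
  apply: cvg_cabs; rewrite (pseries_derive1n0 k f_series).
  under eq_fun do rewrite (pseries_derive1n0 k (Laguerre_pseries (fsL _))).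
  by apply: cvgM; [exact: cvg_cst|exact: coef_cvg].
have [l fl] : exists l, 0 < cabs (derive1n l f 0).
  have [l cl] := pseries_coef_neq0 f_series fz; exists l.
  by rewrite cabs_gt0 (pseries_derive1n0 l f_series) mulf_neq0 ?fact_neq0.
have [M fsM] := log_concave_uniform_bound a0 (fun n => Laguerre_log_concave (fsL n))
  derive_cvg fl (fun b => A_space_bound a0 fA)
  (fun n b => A_space_bound a0 (proj2 (fsA n))) ab.
by exists M => _ [n _ <-]; apply: normA_le (fsM n).
Qed.

End NormA.

Theorem theorem1p2 (R : realType) (a : R) (fs : nat -> CC R -> CC R)
    (f : CC R -> CC R) :
  0 <= a ->
  (forall n, Laguerre_a a (fs n)) ->
  cvg_compact fs f ->
  A_space a f ->
  (exists z, f z != 0) ->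
  [/\ bounded_in_A a (range fs), cvg_in_A a fs f & Laguerre f].
Proof.
move=> a0 fsA /cvg_compact_pointwise fsf fA f_neq0.
have fsL n : Laguerre (fs n) by have [] := fsA n.
have fsB := Laguerre_bounded_in_A a0 fsA fsf fA f_neq0.
have [f_series coef_cvg] := Laguerre_cvg_coef fsL fsf.
split=> //; last exact: Laguerre_closed fsL fsf f_neq0.
exact: bounded_cvg_in_A a0 (fun n => Laguerre_pseries (fsL n)) f_series coef_cvg fsB.
Qed.
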